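(* Let $\lambda>0$, $0\le\mu\le\lambda$, put $\rho=\mu/\lambda$, and let $\sigma\in[0,1]$ and $n\ge 1$ an integer. Consider the constant rate birth and death process with birth rate $\lambda$ and death rate $\mu$, where the time since origin of the tree is unknown and has the uniform prior on $[0,\infty)$. Let $M_\sigma$ be the number of lineages in the reconstructed tree when the fraction $\sigma$ of the time from the origin until today is over, so that $M_1$ is the number of species today. Then $$\mathbb{E}[M_\sigma\mid M_1=n]=\begin{cases}\displaystyle 1+n(n-1)\sum_{k=0}^{n-2}\binom{n-2}{k}\frac{(-1)^k}{k+2}\,\frac{\sigma}{k+2-\sigma} & \text{if }\mu=0,\\[4mm] \displaystyle 1+n(n-1)\,\sigma\int_0^\infty\frac{t^{n-1}}{(1+(1-\sigma)t)(1+t)^{n+1}}\,dt & \text{if }\mu=\lambda,\\[4mm] \displaystyle 1+n(n-1)(\rho-1)^2\int_0^\infty\frac{e^{-(2-\sigma)t}-e^{-2t}}{1-\rho e^{-(1-\sigma)t}}\,\frac{(1-e^{-t})^{n-2}}{(1-\rho e^{-t})^{n+1}}\,dt & \text{otherwise.}\end{cases}$$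
   Context: Constant rate birth and death process: it starts at time $0$ (the origin of the tree) with a single lineage; independently, each lineage existing at a given time splits into two lineages at rate $\lambda$ and dies at rate $\mu$. The reconstructed tree at time $t$ is the genealogical tree up to time $t$ from which all lineages having no descendants alive at time $t$ have been removed. For fixed $t>0$ and $\sigma\in[0,1]$, $M_{\sigma,t}$ denotes the number of lineages alive at time $\sigma t$ which have at least one descendant (possibly the lineage itself) alive at time $t$; so $M_{1,t}$ is the number of lineages alive at time $t$. When the age of the tree is unknown, it is given the (improper) uniform prior on $[0,\infty)$. Conditioned on having $n$ species today, the time of origin then has the density $$q_{or}(t\mid n)=\frac{\mathbb{P}[M_{1,t}=n]}{\int_0^\infty\mathbb{P}[M_{1,s}=n]\,ds}=n\lambda^n(\lambda-\mu)^2\frac{(1-e^{-(\lambda-\mu)t})^{n-1}e^{-(\lambda-\mu)t}}{(\lambda-\mu e^{-(\lambda-\mu)t})^{n+1}},\qquad t>0,$$ where for $\mu=\lambda$ the right-hand side is understood as its limit $n\lambda^n t^{n-1}/(1+\lambda t)^{n+1}$ as $\mu\to\lambda$. The conditional law of $M_\sigma$ given $M_1=n$ is the corresponding mixture, $\mathbb{P}[M_\sigma=m\mid M_1=n]=\int_0^\infty\mathbb{P}[M_{\sigma,t}=m\mid M_{1,t}=n]\,q_{or}(t\mid n)\,dt$, so that $$\mathbb{E}[M_\sigma\mid M_1=n]=\int_0^\infty\mathbb{E}[M_{\sigma,t}\mid M_{1,t}=n]\,q_{or}(t\mid n)\,dt.$$ *)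

(* Defs.v *)
From HB Require Import structures.
From mathcomp Require Import all_boot all_order all_algebra.
From mathcomp Require Import all_classical all_reals all_analysis.
Set Implicit Arguments.
Unset Strict Implicit.
Unset Printing Implicit Defensive.
Import Order.TTheory GRing.Theory Num.Theory.
Import numFieldNormedType.Exports.
Local Open Scope classical_set_scope.
Local Open Scope ring_scope.

(* Lineages are labelled by binary words: the initial lineage is [::], and when
   the lineage u splits it is replaced by rcons u false and rcons u true, so
   that the descendants of u (u included) are the v with prefix u v.
   life u is the time between the birth of u and the event that ends it;
   split u tells whether this event is a split (true) or a death (false). Both
   are defined for every word, including those that never come to exist. *)
Section genealogy.
Context d (T : measurableType d) (R : realType) (P : probability T R).
Variables (life : seq bool -> {RV P >-> R}) (split : seq bool -> {RV P >-> bool}).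

Definition birth_time (u : seq bool) (w : T) : R :=
  \sum_(i < size u) life (take i u) w.

Definition alive (t : R) (w : T) : set (seq bool) :=
  [set u | (forall i, (i < size u)%N -> split (take i u) w) /\
           birth_time u w <= t < birth_time u w + life u w].

Definition reconstructed (s t : R) (w : T) : set (seq bool) :=
  [set u | alive s w u /\ exists2 v, prefix u v & alive t w v].

(* M_{sigma,t}, with value +oo when there are infinitely many such lineages *)
Definition nb_lineages (sigma t : R) (w : T) : \bar R :=
  counting (reconstructed (sigma * t) t w).

Definition nb_lineages_eq (sigma t : R) (n : nat) : set T :=
  [set w | nb_lineages sigma t w = n%:R%:E].

(* Constant rates lambda (split) and mu (death), independently for every
   lineage: the first event occurs after an exponential time of rate
   lambda + mu, and is, independently of this time, a split with probability
   lambda / (lambda + mu) and a death otherwise. *)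
Record birth_death_tree (lambda mu : R) : Prop := BirthDeathTree {
  life_exponential : forall u (A : set R), measurable A ->
    distribution P (life u) A = exponential_prob (lambda + mu) A ;
  split_bernoulli : forall u (B : set bool), measurable B ->
    distribution P (split u) B = bernoulli_prob (lambda / (lambda + mu)) B ;
  life_split_independent : forall (s : seq (seq bool))
      (A : seq bool -> set R) (B : seq bool -> set bool),
    uniq s ->
    (forall u, measurable (A u)) -> (forall u, measurable (B u)) ->
    P (\bigcap_(u in [set` s]) (life u @^-1` A u `&` split u @^-1` B u)) =
    (\prod_(u <- s) (P (life u @^-1` A u) * P (split u @^-1` B u)))%E }.

Local Open Scope ereal_scope.

(* P[M_{sigma,t} = m | M_{1,t} = n] *)
Definition cond_prob_nb_lineages (sigma t : R) (m n : nat) : \bar R :=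
  P (nb_lineages_eq sigma t m `&` nb_lineages_eq 1 t n) /
  P (nb_lineages_eq 1 t n).

(* density of the time of origin given n species today, under the improper
   uniform prior on [0, +oo[ *)
Definition q_or (t : R) (n : nat) : \bar R :=
  P (nb_lineages_eq 1 t n) /
  \int[lebesgue_measure]_(s in `[0%R, +oo[) P (nb_lineages_eq 1 s n).

(* P[M_sigma = m | M_1 = n], the age of the tree being unknown *)
Definition cond_law (sigma : R) (m n : nat) : \bar R :=
  \int[lebesgue_measure]_(t in `[0%R, +oo[)
    (cond_prob_nb_lineages sigma t m n * q_or t n).

(* E[M_sigma | M_1 = n]; given M_1 = n, M_sigma takes values in {0, ..., n} *)
Definition cond_expectation (sigma : R) (n : nat) : \bar R :=
  \sum_(0 <= m <oo) m%:R%:E * cond_law sigma m n.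

End genealogy.

(* Main.v *)
(* Decompose at the event ending the root lineage: its two subtrees are
   independent copies of the whole tree. For a fixed lag tau, the function
   h s = E[a ^ M_s b ^ M_(s + tau)], with M_s the number of lineages at s with
   descendants at s + tau, therefore solves the integral form of the Riccati
   equation h' = lambda h ^ 2 - (lambda + mu) h + mu, whose bounded solution is
   unique and is a linear fractional function of h 0. Extracting coefficients in
   a and b gives P[M_(1,t) = n] and sum_m m P[M_(sigma,t) = m, M_(1,t) = n]
   explicitly, and the integral of the former over t is 1 / (n lambda). Writing
   B t for the parameter of the geometric law of M_(1,t) given survival,
     E[M_sigma | M_1 = n] = 1 + n (n - 1) int_0^oo lambda (1 - rho B t) (1 - B t)
       (B t - B ((1 - sigma) t)) (B t) ^ (n - 2) dt.
   Rescaling time by lambda - mu (by lambda if mu = lambda) gives the integrals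
   of the theorem, and for mu = 0 the binomial formula gives the finite sum. *)
Require Import Defs.
From HB Require Import structures.
From mathcomp Require Import all_boot all_order all_algebra.
From mathcomp Require Import all_classical all_reals all_analysis.
From mathcomp Require Import measurable_realfun ring lra.
Set Implicit Arguments.
Unset Strict Implicit.
Unset Printing Implicit Defensive.
Import Order.TTheory GRing.Theory Num.Theory.
Import numFieldNormedType.Exports.
Local Open Scope classical_set_scope.
Local Open Scope ring_scope.

(** Words that never come to exist carry marks too, so the marks form one independent family over
    all binary words. Pushed forward to the space of marked words, the independence of the subtrees
    becomes an equality of two measures, and the identities about [graft] are free of probability.
    Two things can go wrong on a single configuration: a lifetime may be negative, which is a null
    event, and the number of lineages may be infinite. Explosion is not ruled out in advance: [gpow]
    gives weight 0 to an infinite count, which keeps it multiplicative, so the integral equation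
    holds and uniqueness of its bounded solution still identifies the generating function. The
    initial value of the equation is affine in a: with N the population at the lag tau, the number
    of lineages at time 0 with descendants is the indicator of N > 0, and its weight is (1 - a) 0 ^
    N + a b ^ N. The means of 0 ^ N and b ^ N are again flow values, at lag 0, so one uniqueness
    statement serves twice. Coefficients are compared first in a for fixed b, then averaged over m,
    and only then compared in b; the joint law itself is never computed. *)

(** * Counting measure: cardinals and measurability *)

Section counting_measure_facts.
Context {R : realType}.
Local Open Scope ereal_scope.

Lemma counting_image (T U : choiceType) (f : T -> U) (A : set T) :
  injective f -> counting (f @` A) = counting A :> \bar R.
Proof.
move=> injf; rewrite /counting.
have finE : finite_set (f @` A) = finite_set A.
  apply/propext; split=> [fA|]; last exact: finite_image.
  apply: (@sub_finite_set _ _ (f @^-1` (f @` A))); first by move=> x Ax; exists x.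
  by apply: finite_preimage => // x y _ _; exact: injf.
rewrite finE; case: ifPn => // /asboolP fA.
by rewrite fset_set_image// finmap.card_imfset.
Qed.

Lemma counting_setU (T : choiceType) (A B : set T) : A `&` B = set0 ->
  counting (A `|` B) = counting A + counting B :> \bar R.
Proof.
move=> AB0; rewrite /counting finite_setU asbool_and.
have [fA|fA] := asboolP (finite_set A); have [fB|fB] := asboolP (finite_set B) => //=.
rewrite fset_setU// finmap.cardfsU -fset_setI// AB0 fset_set0 finmap.cardfs0 subn0.
by rewrite natrD.
Qed.

Lemma countingP (T : choiceType) (A : set T) :
  counting A = +oo :> \bar R \/ exists n, counting A = n%:R%:E :> \bar R.
Proof. by rewrite /counting; case: ifPn => _; [right; eexists|left]. Qed.

Lemma counting_eq0 (T : choiceType) (A : set T) :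
  (counting A == 0 :> \bar R) = `[< A = set0 >].
Proof.
rewrite /counting; case: ifPn => [/asboolP fA|/asboolP fA].
  rewrite eqe pnatr_eq0 finmap.cardfs_eq0; apply/eqP/asboolP => [|->].
    by move=> A0; rewrite -(fset_setK fA) A0 set_fset0.
  by rewrite fset_set0.
by apply/esym; rewrite asboolF// => A0; apply: fA; rewrite A0.
Qed.

(** Counting is the sum of the Dirac masses at all natural numbers, evaluated on the codes of the
    elements; each term is the indicator of a measurable event. *)
Lemma measurable_counting d (X : measurableType d) (I : countType)
    (A : X -> set I) : (forall i, measurable [set x | A x i]) ->
  measurable_fun setT (fun x => counting (A x) : \bar R).
Proof.
move=> mA.
rewrite (_ : (fun x => _) =
    (fun x => \sum_(0 <= n <oo | n \in predT) \d_n (pickle @` A x))); last first.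
  apply/funext => x; rewrite -(counting_image (A x) (pcan_inj (@pickleK I))).
  exact: counting_dirac.
apply: ge0_emeasurable_sum => // n _.
rewrite (_ : (fun x => _) = EFin \o \1_[set x | (pickle @` A x) n]); last first.
  apply/funext => x; rewrite /= diracE indicE.
  by case: (boolP (n \in _)) => /asboolP nA; [rewrite mem_set|rewrite memNset].
apply/measurable_EFinP; apply: measurable_indic.
have [[i Ei]|noi] := pselect (exists i : I, pickle i = n).
  rewrite (_ : [set x | _] = [set x | A x i])//.
  apply/seteqP; split => x /=; last by exists i.
  by move=> [j Aj jn]; rewrite (pcan_inj pickleK (etrans Ei (esym jn))).
rewrite (_ : [set x | _] = set0)//.
by apply/seteqP; split => x //= -[i _ ni]; case: noi; exists i.
Qed.

Lemma measurable_forall d (X : measurableType d) (I : countType)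
    (A : I -> set X) : (forall i, measurable (A i)) ->
  measurable [set x | forall i, A i x].
Proof.
move=> mA.
rewrite (_ : [set x | _] =
  \bigcap_n (if unpickle n is Some i then A i else setT)); last first.
  apply/seteqP; split => x /= H.
    by move=> n _; case: unpickle.
  by move=> i; have := H (pickle i) Logic.I; rewrite pickleK.
by apply: bigcapT_measurable => n; case: unpickle.
Qed.

End counting_measure_facts.

Lemma measurable_exists d (X : measurableType d) (I : countType)
    (A : I -> set X) : (forall i, measurable (A i)) ->
  measurable [set x | exists i, A i x].
Proof.
move=> mA; rewrite (_ : [set x | _] = ~` [set x | forall i, (~` A i) x]).
  by apply/measurableC/measurable_forall => i; exact: measurableC.
apply/seteqP; split => x /=; first by move=> [i Ai] /(_ i).
by move=> /existsNP[i /contrapT Ai]; exists i.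
Qed.

(** * Pathwise identities for trees of marks *)

Section marked_trees.
Context {R : realType}.
Implicit Types (w : seq bool -> R * bool) (u v : seq bool).

(** These definitions mirror [birth_time], [alive], [reconstructed] and [nb_lineages] for one fixed
    configuration of marks (lifetime, split or death); composed with the random marks they are
    convertible to the originals. *)
Definition birth w u : R := \sum_(i < size u) (w (take i u)).1.

Definition living (t : R) w : set (seq bool) :=
  [set u | (forall i, (i < size u)%N -> (w (take i u)).2) /\
           birth w u <= t < birth w u + (w u).1].

Definition ancestral (s t : R) w : set (seq bool) :=
  [set u | living s w u /\ exists2 v, prefix u v & living t w v].

Definition nb_ancestral (s t : R) w : \bar R := counting (ancestral s t w).

(** Inverse of the decomposition of a tree at the event that ends its root. *)
Definition graft (x : R * bool) w0 w1 : seq bool -> R * bool :=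
  fun u => if u is b :: v then (if b then w1 else w0) v else x.

(** Holds only almost surely for exponential lifetimes. With a negative lifetime, a descendant could
    be alive before the root event. *)
Definition nonneg_tree w := forall u, 0 <= (w u).1.

Lemma ancestral_refl t w : ancestral t t w = living t w.
Proof.
apply/seteqP; split => u; first by move=> [].
by move=> Lu; split => //; exists u => //; exact: prefix_refl.
Qed.

Lemma living_graft_nil t x w0 w1 :
  living t (graft x w0 w1) [::] <-> 0 <= t < x.1.
Proof.
rewrite /living /= /birth big_ord0 add0r; split=> [[]//|].
by move=> ?; split.
Qed.

Lemma living_graft_cons t x w0 w1 b v :
  living t (graft x w0 w1) (b :: v) <->
  x.2 /\ living (t - x.1) (if b then w1 else w0) v.
Proof.
have B : birth (graft x w0 w1) (b :: v) = x.1 + birth (if b then w1 else w0) v.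
  by rewrite /birth big_ord_recl.
rewrite /living /= B lerBrDl ltrBlDl addrA; split=> [[H1 H2]|[x2 [H1 H2]]].
  split; first exact: (H1 0%N isT).
  by split=> // i iv; exact: (H1 i.+1).
by split=> // -[|i]; [|exact: H1].
Qed.

Lemma living_lt0 t w : nonneg_tree w -> t < 0 -> living t w = set0.
Proof.
move=> w0 t0; apply/seteqP; split => // u [_ /andP[+ _]].
by rewrite leNgt (lt_le_trans t0)//; apply: sumr_ge0 => i _; exact: w0.
Qed.

Lemma ancestral_graft_cons s t x w0 w1 b v :
  ancestral s t (graft x w0 w1) (b :: v) <->
  x.2 /\ ancestral (s - x.1) (t - x.1) (if b then w1 else w0) v.
Proof.
rewrite /ancestral /= living_graft_cons; split.
  move=> [[x2 Lv] [[|b' v'] //= /andP[/eqP<- vv'] /living_graft_cons[_ Lv']]].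
  by split => //; split => //; exists v'.
move=> [x2 [Lv [v' vv' Lv']]]; split => //; exists (b :: v').
  by rewrite /= eqxx.
exact/living_graft_cons.
Qed.

Lemma ancestral_graft s t x w0 w1 : x.1 <= s ->
  ancestral s t (graft x w0 w1) =
  if x.2 then cons false @` ancestral (s - x.1) (t - x.1) w0 `|`
              cons true @` ancestral (s - x.1) (t - x.1) w1
  else set0.
Proof.
move=> xs; apply/seteqP; split => [[|b v]|].
- by move=> [/living_graft_nil/andP[_]]; rewrite ltNge xs.
- by move=> /ancestral_graft_cons[-> +]; case: b => H; [right|left]; exists v.
- move=> u; case: ifPn => // x2.
  by move=> [[v Hv <-]|[v Hv <-]]; apply/ancestral_graft_cons.
Qed.

Lemma nb_ancestral_graft s t x w0 w1 : x.1 <= s ->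
  nb_ancestral s t (graft x w0 w1) =
  (if x.2 then nb_ancestral (s - x.1) (t - x.1) w0 +
               nb_ancestral (s - x.1) (t - x.1) w1
   else 0)%E.
Proof.
move=> xs; rewrite /nb_ancestral ancestral_graft//; case: ifPn => _.
  have injc (b : bool) : injective (cons b) by move=> u v [].
  rewrite counting_setU ?counting_image//.
  by apply/seteqP; split => // u [[v _ <-] [v' _]].
by apply/eqP; rewrite counting_eq0; apply/asboolP.
Qed.

(** Before the root event the root is the only living lineage, because in the subtrees the clock
    still shows a negative time. Whether it counts depends only on survival up to t. *)
Lemma nb_ancestral_graft_root s t x w0 w1 : nonneg_tree w0 -> nonneg_tree w1 ->
  0 <= s < x.1 ->
  nb_ancestral s t (graft x w0 w1) =
  (if nb_ancestral t t (graft x w0 w1) == 0 then 0 else 1)%E.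
Proof.
move=> w0_ge0 w1_ge0 /andP[s0 sx]; rewrite {2}/nb_ancestral counting_eq0 ancestral_refl.
have LE u : living s (graft x w0 w1) u <-> u = [::].
  split=> [|->]; last by apply/living_graft_nil; rewrite s0.
  case: u => // b v /living_graft_cons[_]; rewrite living_lt0 ?subr_lt0//.
  by case: b.
case: ifPn => /asboolP Lt.
  apply/eqP; rewrite counting_eq0; apply/asboolP/seteqP; split => // u.
  by move=> [_ [v _]]; rewrite Lt.
have [v Lv] : living t (graft x w0 w1) !=set0 by apply/set0P/eqP.
rewrite /nb_ancestral (_ : ancestral _ _ _ = [set [::]]).
  by rewrite /counting asboolT// fset_set1 finmap.cardfs1.
apply/seteqP; split => [u [/LE]//|_ ->]; split; first exact/LE.
by exists v => //; exact: prefix0s.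
Qed.

(** Pathwise half of the lack of memory: removing the first s units from the life of the root and
    from the clock does not change who is alive. The other half is the translation of the
    exponential density in [pgf_integral_equation]. *)
Lemma nb_ancestral_graft_shift s t x w0 w1 : 0 <= s <= t ->
  nb_ancestral t t (graft x w0 w1) =
  nb_ancestral (t - s) (t - s) (graft (x.1 - s, x.2) w0 w1).
Proof.
move=> /andP[s0 st]; congr counting; rewrite !ancestral_refl; apply/seteqP.
have tx : t - s - (x.1 - s) = t - x.1 by lra.
split => [[|b v]|[|b v]].
- move=> /living_graft_nil/andP[t0 tx1]; apply/living_graft_nil => /=.
  by rewrite subr_ge0 st ltrD2r.
- by move=> /living_graft_cons[x2 Lv]; apply/living_graft_cons; rewrite /= tx.
- move=> /living_graft_nil/=; rewrite ltrD2r => /andP[_ tx1].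
  by apply/living_graft_nil; rewrite (le_trans s0).
- by move=> /living_graft_cons/=; rewrite tx => -[x2 Lv]; apply/living_graft_cons.
Qed.

End marked_trees.

(** * The measurable space of marked trees *)

Section tree_space.
Context {R : realType}.

Definition tree_cylinder (A : seq bool -> set R) (B : seq bool -> set bool) :
    set (seq bool -> R * bool) :=
  [set w | forall u, A u (w u).1 /\ B u (w u).2].

(** Constraints stop at a finite depth [k], so that independence over finite families gives the
    measure of each cylinder; the class is still stable under intersection, as uniqueness of
    measures requires. *)
Definition tree_cylinders : set (set (seq bool -> R * bool)) :=
  [set E | exists A B, [/\ forall u, measurable (A u),
    exists k, forall u, (k <= size u)%N -> A u = setT /\ B u = setT
    & E = tree_cylinder A B]].

Definition tree_space := g_sigma_algebraType tree_cylinders.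

HB.instance Definition _ := Measurable.on tree_space.

Lemma measurable_fun_tree d (X : measurableType d) (W : X -> tree_space) :
  (forall u, measurable_fun setT (fun x => W x u)) -> measurable_fun setT W.
Proof.
move=> mW.
have E : @measurable _ tree_space = <<s tree_cylinders >> by [].
apply: (@measurability _ _ X tree_space setT W tree_cylinders E).
move=> _ [_ [A [B [mA _ ->]]] <-]; rewrite setTI.
apply: measurable_forall => u.
have mu1 := measurableT_comp (@measurable_fst _ _ _ _) (mW u).
have mu2 := measurableT_comp (@measurable_snd _ _ _ _) (mW u).
apply: measurableI.
  by rewrite -[X in measurable X]setTI; exact: mu1.
by rewrite -[X in measurable X]setTI; exact: mu2.
Qed.

Lemma measurable_mark u : measurable_fun setT (fun w : tree_space => w u).
Proof.
have cyl1 (A : set R) (B : set bool) : measurable A ->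
    measurable [set w : tree_space | A (w u).1 /\ B (w u).2].
  move=> mA; apply: sub_sigma_algebra.
  exists (fun v => if v == u then A else setT), (fun v => if v == u then B else setT).
  split.
  - by move=> v; case: ifP.
  - exists (size u).+1 => v; have [->|//] := eqVneq v u.
    by rewrite ltnn.
  - apply/seteqP; split=> w /=.
      by move=> [Aw Bw] v; have [->|] := eqVneq v u.
    by move=> /(_ u); rewrite eqxx.
apply/measurable_fun_pairP; split.
- move=> _ A mA; rewrite setTI.
  rewrite (_ : _ @^-1` A = [set w : tree_space | A (w u).1 /\ setT (w u).2]).
    exact: cyl1.
  by apply/seteqP; split=> w /=; [|move=> []].
- move=> _ B _; rewrite setTI.
  rewrite (_ : _ @^-1` B = [set w : tree_space | setT (w u).1 /\ B (w u).2]).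
    exact: cyl1.
  by apply/seteqP; split=> w /=; [|move=> []].
Qed.

Lemma tree_measure_unique (m1 m2 : probability tree_space R) :
  (forall E, tree_cylinders E -> m1 E = m2 E) ->
  forall E, measurable E -> m1 E = m2 E.
Proof.
move=> m12 E mE; apply: (@measure_unique _ R tree_space tree_cylinders (fun=> setT)) => //.
- move=> _ _ [A [B [mA [k AB] ->]]] [A' [B' [mA' [k' AB'] ->]]].
  exists (fun u => A u `&` A' u), (fun u => B u `&` B' u); split.
  + by move=> u; exact: measurableI.
  + exists (maxn k k') => u; rewrite geq_max => /andP[/AB[-> ->] /AB'[-> ->]].
    by rewrite !setTI.
  + apply/seteqP; split=> w /=; first by move=> [H H'] u; have [] := H u; have [] := H' u.
    by move=> H; split=> u; have [[? ?] [? ?]] := H u.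
- move=> _; exists (fun=> setT), (fun=> setT); split => //; first by exists 0%N.
  by apply/seteqP; split.
- by rewrite bigcup_const.
- by move=> n; rewrite (le_lt_trans (probability_le1 _ _))// ltry.
Qed.

Section measurable_counts.
Context d (X : measurableType d) (S U : X -> R) (W : X -> tree_space).
Hypotheses (mS : measurable_fun setT S) (mU : measurable_fun setT U)
  (mW : measurable_fun setT W).

Let mmark u : measurable_fun setT (fun x => W x u).
Proof. exact: (measurableT_comp (measurable_mark u) mW). Qed.

Lemma measurable_living u : measurable [set x | living (S x) (W x) u].
Proof.
have ml v := measurableT_comp (@measurable_fst _ _ _ _) (mmark v).
have ms v := measurableT_comp (@measurable_snd _ _ _ _) (mmark v).
have mb : measurable_fun setT (fun x => birth (W x) u).
  by apply: measurable_sum => i; exact: ml.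
apply: measurableI.
  apply: measurable_forall => i; case: (ltnP i (size u)) => iu.
    rewrite (_ : (fun x => _) = (fun x => (W x (take i u)).2) @^-1` [set true]).
      by rewrite -[X in measurable X]setTI; exact: ms.
    by apply/seteqP; split=> x /=; [exact|].
  rewrite (_ : (fun x => _) = setT)//.
  by apply/seteqP; split=> x.
rewrite [X in measurable X](_ : _ =
  (fun x => (birth (W x) u <= S x) && (S x < birth (W x) u + (W x u).1)) @^-1` [set true])//.
rewrite -[X in measurable X]setTI.
apply: measurable_and => //; first exact: measurable_fun_ler.
apply: measurable_fun_ltr => //; apply: measurable_funD => //; exact: ml.
Qed.

End measurable_counts.

Lemma measurable_nb_ancestral d (X : measurableType d) (S U : X -> R) (W : X -> tree_space) :
  measurable_fun setT S -> measurable_fun setT U -> measurable_fun setT W ->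
  measurable_fun setT (fun x => nb_ancestral (S x) (U x) (W x)).
Proof.
move=> mS mU mW; apply: measurable_counting => u.
apply: measurableI; first exact: measurable_living.
rewrite (_ : (fun x => _) = [set x | exists v, ([set x | prefix u v] `&`
  [set x | living (U x) (W x) v]) x]).
  apply: measurable_exists => v; apply: measurableI; last exact: measurable_living.
  case: (prefix u v).
    by rewrite [X in measurable X](_ : _ = setT)//; apply/seteqP; split.
  by rewrite [X in measurable X](_ : _ = set0)//; apply/seteqP; split.
by apply/seteqP; split=> x [v]; [exists v|move=> []; exists v].
Qed.

Lemma measurable_nonneg_tree : measurable [set w : tree_space | nonneg_tree w].
Proof.
apply: measurable_forall => u.
have ml := measurableT_comp (@measurable_fst _ _ _ _) (measurable_mark u).
rewrite (_ : (fun w => _) = (fun w : tree_space => 0 <= (w u).1) @^-1` [set true])//.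
by rewrite -[X in measurable X]setTI; exact: measurable_fun_ler.
Qed.

Lemma measurable_graft d (X : measurableType d) (x : X -> R * bool) (W0 W1 : X -> tree_space) :
  measurable_fun setT x -> measurable_fun setT W0 -> measurable_fun setT W1 ->
  measurable_fun setT (fun y => graft (x y) (W0 y) (W1 y) : tree_space).
Proof.
move=> mx m0 m1; apply: measurable_fun_tree => -[|[] v] //=.
  exact: (measurableT_comp (measurable_mark v)).
exact: (measurableT_comp (measurable_mark v)).
Qed.

End tree_space.

(** * Integration against the exponential law *)

Section exponential_density.
Context {R : realType}.

(** [p] agrees almost everywhere with the Radon-Nikodym derivative of [m], since both have the same
    integral over every measurable set. *)
Lemma integral_density (m : probability (measurableTypeR R) R) (p : R -> R)
    (f : R -> \bar R) :
  measurable_fun setT p -> (forall x, 0 <= p x) ->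
  (forall A : set (measurableTypeR R), measurable A ->
    (m A = \int[lebesgue_measure]_(x in A) (p x)%:E)%E) ->
  measurable_fun setT f -> (forall x, (0 <= f x <= 1)%E) ->
  (\int[m]_x f x = \int[lebesgue_measure]_x (f x * (p x)%:E))%E.
Proof.
move=> mp p0 mE mf f01.
have dom : m `<< (@lebesgue_measure R).
  apply/null_content_dominatesP => A mA A0; rewrite mE//.
  by apply: null_set_integral => //; apply/measurable_EFinP; exact: measurable_funTS.
have fi : m.-integrable setT f.
  apply: (@le_integrable _ _ _ _ _ _ _ (cst 1%E)) => //.
    by move=> x _ /=; have /andP[f0 f1] := f01 x; rewrite gee0_abs// normr1.
  exact: finite_measure_integrable_cst.
rewrite -(Radon_Nikodym_change_of_variables dom)//.
apply: ae_eq_integral => //.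
- exact: emeasurable_funM.
- by apply: emeasurable_funM => //; exact/measurable_EFinP.
- apply: ae_eqe_mul2l => /=.
  rewrite Radon_NikodymE//=.
  case: cid => /= h [h1 h2 h3].
  apply: integral_ae_eq => //=.
  + exact/measurable_EFinP.
  + by move=> A _ mA; rewrite -h3//= mE.
Qed.

Lemma integral_exponential_law (E : probability R R) (c : R) (f : R -> \bar R) : 0 < c ->
  (forall A : set R, measurable A -> E A = exponential_prob c A) ->
  measurable_fun setT f -> (forall x, (0 <= f x <= 1)%E) ->
  (\int[E]_x f x =
   \int[lebesgue_measure]_(x in `[0%R, +oo[) (f x * (c * expR (- c * x))%:E))%E.
Proof.
move=> c0 EE mf f01.
(* The identity transports the law to the copy of the reals on which the Lebesgue measure is
   defined. *)
have mid : @measurable_fun _ _ R (measurableTypeR R) setT idfun.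
  by move=> _ A mA; rewrite setTI.
pose X : {mfun R >-> measurableTypeR R} := HB.pack idfun (isMeasurableFun.Build _ _ _ _ _ mid).
have -> : (\int[E]_x f x = \int[distribution E X]_x f x)%E.
  by rewrite ge0_integral_pushforward// => x _; have /andP[] := f01 x.
rewrite (@integral_density _ (exponential_pdf c))//.
- rewrite [RHS]integral_mkcond; apply: eq_integral => x _.
  rewrite patchE /exponential_pdf patchE; case: ifPn => // _.
  by rewrite mule0.
- exact: measurable_exponential_pdf.
- by move=> x; exact/exponential_pdf_ge0/ltW.
Qed.

(** Translation invariance: the image of the Lebesgue measure under a translation gives half-open
    intervals their length, hence is the Lebesgue measure. *)
Lemma lebesgue_integral_shift (f : R -> \bar R) (s : R) :
  measurable_fun setT f -> (forall x, 0 <= f x)%E ->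
  (\int[lebesgue_measure]_(x in `]s, +oo[) f (x - s)%R =
   \int[lebesgue_measure]_(x in `]0%R, +oo[) f x)%E.
Proof.
move=> mf f0.
pose phi : R -> measurableTypeR R := fun x => x - s.
have mphi : @measurable_fun _ _ (measurableTypeR R) (measurableTypeR R) setT phi.
  exact: measurable_funB.
rewrite (_ : `]s, +oo[%classic = phi @^-1` `]0, +oo[%classic); last first.
  by apply/seteqP; split => x; rewrite /= !in_itv/= !andbT subr_gt0.
rewrite -(@ge0_integral_pushforward _ _ (measurableTypeR R) (measurableTypeR R) _
  phi mphi lebesgue_measure _ f)//; last exact: measurable_funTS.
apply: eq_measure_integral => //= A mA _; apply/esym/lebesgue_measure_unique => //=.
move=> _ [[a b]] _ <-.
rewrite /pushforward (_ : phi @^-1` _ = `]a + s, b + s]%classic); last first.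
  by apply/seteqP; split => x; rewrite /= !in_itv/= ltrBrDr lerBlDr.
by rewrite !lebesgue_measure_itv/= !lte_fin ltrD2r; case: ifPn => // _; congr EFin; ring.
Qed.

End exponential_density.

(** * Derivatives of quotients, affine images and exponentials *)

Section derivative_quotient.
Context {R : realType}.

Lemma is_derive_div (f g : R -> R) (x df dg : R) :
  is_derive x 1 f df -> is_derive x 1 g dg -> g x != 0 ->
  is_derive x 1 (fun t => f t / g t) ((df * g x - f x * dg) / g x ^+ 2).
Proof.
move=> Df Dg gx0.
have Dgi : is_derive x 1 (fun t => (g t)^-1) (- (g x) ^- 2 * dg).
  exact: is_deriveV.
apply: (@is_derive_eq _ _ _ (f * (fun t => (g t)^-1)) x 1 _ _ (is_deriveM Df Dgi)).
by rewrite /= /GRing.scale /=; field.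
Qed.

Lemma is_derive_affine (a k : R) (f : R -> R) (x df : R) :
  is_derive x 1 f df -> is_derive x 1 (fun t : R => a + k * f t) (k * df).
Proof.
move=> Df; have H := is_deriveD (is_derive_cst a x 1) (is_deriveZ k Df).
by move: H; rewrite add0r.
Qed.

Lemma is_derive_expRM (k x : R) :
  is_derive x 1 (fun t => expR (k * t)) (k * expR (k * x)).
Proof.
have Dk : is_derive x 1 (fun t => k * t) k.
  apply: (@is_derive_eq _ _ _ (k \*: id) x 1 _ _ (is_deriveZ k (is_derive_id x 1))).
  by rewrite /GRing.scale /= mulr1.
rewrite [X in is_derive _ _ _ X]mulrC.
exact: (@is_derive1_comp _ expR (fun t => k * t) x _ _ (is_derive_expR (k * x)) Dk).
Qed.

Lemma is_derive_continuous (f : R -> R) (x df : R) : is_derive x 1 f df ->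
  {for x, continuous f}.
Proof.
by move=> Df; apply/differentiable_continuous/derivable1_diffP; exact: ex_derive.
Qed.

End derivative_quotient.

(** * The Riccati flow and uniqueness for its integral equation *)

Section birth_death_flow.
Context {R : realType} (lambda mu : R).
Hypotheses (lambda_gt0 : 0 < lambda) (mu_ge0 : 0 <= mu) (mu_le : mu <= lambda).
Let rho := mu / lambda.

Let lambda_neq0 : lambda != 0. Proof. by rewrite gt_eqF. Qed.

Let rho_ge0 : 0 <= rho. Proof. by rewrite divr_ge0// ltW. Qed.

Let rho_le1 : rho <= 1. Proof. by rewrite ler_pdivrMr// mul1r. Qed.

Let muE : mu = rho * lambda. Proof. by rewrite divfK. Qed.

(* The parameter of the geometric law of the population size at time t, given
   survival. *)
Definition bd_beta (t : R) : R :=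
  if mu == lambda then lambda * t / (1 + lambda * t)
  else (1 - expR (- (lambda - mu) * t)) / (1 - rho * expR (- (lambda - mu) * t)).

Let den_gt0 (t : R) : 0 <= t -> mu != lambda -> 0 < 1 - rho * expR (- (lambda - mu) * t).
Proof.
move=> t0 ml; have rl : rho < 1 by rewrite ltr_pdivrMr// mul1r lt_neqAle ml.
rewrite subr_gt0 (le_lt_trans _ rl)// ler_piMr//.
by rewrite -expR0 ler_expR mulNr oppr_le0 mulr_ge0// subr_ge0.
Qed.

Let crit_gt0 (t : R) : 0 <= t -> 0 < 1 + lambda * t.
Proof. by move=> t0; rewrite ltr_pwDl// mulr_ge0// ltW. Qed.

Lemma bd_beta0 : bd_beta 0 = 0.
Proof. by rewrite /bd_beta; case: ifP => _; rewrite mulr0 ?expR0 ?subrr mul0r. Qed.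

Lemma bd_beta_gt0 (t : R) : 0 < t -> 0 < bd_beta t.
Proof.
move=> t0; rewrite /bd_beta; case: ifPn => ml.
  by rewrite divr_gt0 ?crit_gt0 ?ltW// mulr_gt0.
rewrite divr_gt0 ?den_gt0 ?ltW// subr_gt0 -expR0 ltr_expR mulNr oppr_lt0.
by rewrite mulr_gt0// subr_gt0 lt_neqAle ml.
Qed.

Lemma bd_beta_ge0 (t : R) : 0 <= t -> 0 <= bd_beta t.
Proof.
by rewrite le_eqVlt => /predU1P[<-|/bd_beta_gt0/ltW//]; rewrite bd_beta0.
Qed.

Lemma bd_beta_lt1 (t : R) : 0 <= t -> bd_beta t < 1.
Proof.
move=> t0; rewrite /bd_beta; case: ifPn => ml.
  by rewrite ltr_pdivrMr ?crit_gt0// mul1r ltrDr.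
rewrite ltr_pdivrMr ?den_gt0// mul1r ltrD2l ltrN2 gtr_pMl ?expR_gt0//.
by rewrite ltr_pdivrMr// mul1r lt_neqAle ml.
Qed.

(** Up to the factor [rho], this is the semigroup law of the flow started at 0, whose value at time
    t is [rho * bd_beta t]; the denominator is cleared. *)
Lemma bd_betaD (s t : R) : 0 <= s -> 0 <= t ->
  bd_beta (s + t) * (1 - rho * bd_beta s * bd_beta t) =
  bd_beta s + bd_beta t - (1 + rho) * bd_beta s * bd_beta t.
Proof.
move=> s0 t0; have st0 := addr_ge0 s0 t0; rewrite /bd_beta; case: ifPn => ml.
  rewrite /rho (eqP ml) divff//.
  have := crit_gt0 s0; have := crit_gt0 t0; have := crit_gt0 st0.
  by move=> /gt_eqF/negbT c1 /gt_eqF/negbT c2 /gt_eqF/negbT c3; field; rewrite ?c1 ?c2 ?c3.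
have := den_gt0 s0 ml; have := den_gt0 t0 ml; have := den_gt0 st0 ml.
rewrite mulrDr expRD.
by move=> /gt_eqF/negbT c1 /gt_eqF/negbT c2 /gt_eqF/negbT c3; field; rewrite ?c1 ?c2 ?c3.
Qed.

Lemma is_derive_bd_beta (t : R) : 0 <= t ->
  is_derive t 1 bd_beta (lambda * (1 - rho * bd_beta t) * (1 - bd_beta t)).
Proof.
move=> t0; rewrite /bd_beta; case: ifPn => ml.
  have c0 := negbT (gt_eqF (crit_gt0 t0)).
  have D1 : is_derive t 1 (fun t : R => lambda * t) lambda.
    have := is_derive_affine 0 lambda (is_derive_id t 1).
    by rewrite mulr1; under eq_fun do rewrite add0r.
  have D2 : is_derive t 1 (fun t : R => 1 + lambda * t) lambda.
    by have := is_derive_affine 1 lambda (is_derive_id t 1); rewrite mulr1.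
  apply: (is_derive_eq (is_derive_div D1 D2 c0)).
  by rewrite /rho (eqP ml) divff//; field.
have c0 := negbT (gt_eqF (den_gt0 t0 ml)).
have DE := is_derive_expRM (- (lambda - mu)) t.
have D1 : is_derive t 1 (fun t : R => 1 - expR (- (lambda - mu) * t))
    ((lambda - mu) * expR (- (lambda - mu) * t)).
  have := is_derive_affine 1 (-1) DE; rewrite mulNr mul1r -mulNr opprK.
  by under eq_fun do rewrite mulN1r.
have D2 : is_derive t 1 (fun t : R => 1 - rho * expR (- (lambda - mu) * t))
    (rho * (lambda - mu) * expR (- (lambda - mu) * t)).
  have := is_derive_affine 1 (- rho) DE; rewrite mulNr [- (_ - _) * _]mulNr mulrN opprK mulrA.
  by under eq_fun do rewrite mulNr.
apply: (is_derive_eq (is_derive_div D1 D2 c0)).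
move: c0; set e := expR _ => c0.
have -> : lambda - mu = lambda * (1 - rho) by rewrite {1}muE; ring.
by field.
Qed.

(* The solution of y' = lambda y ^ 2 - (lambda + mu) y + mu with y 0 = x. *)
Definition bd_flow (x t : R) : R :=
  (rho * bd_beta t + x * (1 - (1 + rho) * bd_beta t)) / (1 - bd_beta t * x).

Lemma bd_flow_den_gt0 (x t : R) : 0 <= x <= 1 -> 0 <= t -> 0 < 1 - bd_beta t * x.
Proof.
move=> /andP[x0 x1] t0; rewrite subr_gt0 (@le_lt_trans _ _ (bd_beta t))//.
  by rewrite ler_piMr// bd_beta_ge0.
exact: bd_beta_lt1.
Qed.

Lemma bd_flow0 x : bd_flow x 0 = x.
Proof. by rewrite /bd_flow bd_beta0 !(mulr0, mul0r) add0r !subr0 divr1 mulr1. Qed.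

Lemma bd_flow_bounds (x t : R) : 0 <= x <= 1 -> 0 <= t -> 0 <= bd_flow x t <= 1.
Proof.
move=> x01 t0; have d0 := bd_flow_den_gt0 x01 t0.
have b0 := bd_beta_ge0 t0; have b1 := ltW (bd_beta_lt1 t0).
have rb : rho * bd_beta t <= 1 by exact: mulr_ile1.
have /andP[x0 x1] := x01.
rewrite /bd_flow divr_ge0 ?(ltW d0)//= ?ler_pdivrMr// ?mul1r.
  rewrite -subr_ge0 (_ : _ - _ = (1 - x) * (1 - rho * bd_beta t)); last by ring.
  by rewrite mulr_ge0// subr_ge0.
rewrite (_ : _ + _ = rho * bd_beta t * (1 - x) + x * (1 - bd_beta t)); last by ring.
by apply: addr_ge0; apply: mulr_ge0; rewrite ?subr_ge0//; exact: mulr_ge0.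
Qed.

Lemma is_derive_bd_flow (x t : R) : 0 <= x <= 1 -> 0 <= t ->
  is_derive t 1 (bd_flow x)
    (lambda * bd_flow x t ^+ 2 - (lambda + mu) * bd_flow x t + mu).
Proof.
move=> x01 t0; have d0 := negbT (gt_eqF (bd_flow_den_gt0 x01 t0)).
have Db := is_derive_bd_beta t0.
have D1 : is_derive t 1
    (fun u : R => rho * bd_beta u + x * (1 - (1 + rho) * bd_beta u))
    ((rho - x * (1 + rho)) * (lambda * (1 - rho * bd_beta t) * (1 - bd_beta t))).
  rewrite (_ : (fun u : R => _) = (fun u => x + (rho - x * (1 + rho)) * bd_beta u)).
    exact: is_derive_affine.
  by apply/funext => u; ring.
have D2 : is_derive t 1 (fun u : R => 1 - bd_beta u * x)
    (- x * (lambda * (1 - rho * bd_beta t) * (1 - bd_beta t))).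
  rewrite (_ : (fun u : R => _) = (fun u => 1 + (- x) * bd_beta u)).
    exact: is_derive_affine.
  by apply/funext => u; ring.
apply: (is_derive_eq (is_derive_div D1 D2 d0)).
rewrite /bd_flow; move: d0; set b := bd_beta t => d0.
by rewrite [in RHS]muE; field.
Qed.

Let c := lambda + mu.

Let c_ge0 : 0 <= c. Proof. by rewrite addr_ge0// ltW. Qed.

Let flow_integrand (y : R -> R) (s r : R) : R :=
  expR (- c * r) * (mu + lambda * y (s - r) ^+ 2).

Let is_derive_flow_shift (x s r : R) : 0 <= x <= 1 -> r <= s ->
  is_derive r 1 (fun r => bd_flow x (s - r))
   (- (lambda * bd_flow x (s - r) ^+ 2 - c * bd_flow x (s - r) + mu)).
Proof.
move=> x01 rs; have sr0 : 0 <= s - r by rewrite subr_ge0.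
have Ds : is_derive r 1 (fun r : R => s - r) (-1).
  have := is_derive_affine s (-1) (is_derive_id r 1); rewrite mulr1.
  by under eq_fun do rewrite mulN1r.
rewrite -mulrN1.
exact: (@is_derive1_comp _ (bd_flow x) (fun r => s - r) r _ _ (is_derive_bd_flow x01 sr0) Ds).
Qed.

Let continuous_flow_integrand (x s : R) : 0 <= x <= 1 ->
  {within `[0, s], continuous (flow_integrand (bd_flow x) s)}.
Proof.
move=> x01; apply: continuous_in_subspaceT => r.
rewrite inE /= in_itv /= => /andP[_ rs].
have cy := is_derive_continuous (is_derive_flow_shift x01 rs).
have ce := is_derive_continuous (is_derive_expRM (- c) r).
apply: (@continuousM _ _ (fun r => expR (- c * r))) => //.
apply: (@continuousD _ _ _ (cst mu)); first exact: cst_continuous.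
apply: (@continuousM _ _ (cst lambda)); first exact: cst_continuous.
exact: (continuousM cy cy).
Qed.

(** Integrating factor: for a solution y, the derivative of - exp (- c r) y (s - r) in r is exp (- c
    r) (c y + y'), and the linear term of the Riccati equation cancels c y. *)
Lemma bd_flow_integral (x s : R) : 0 <= x <= 1 -> 0 <= s ->
  (\int[lebesgue_measure]_(r in `[0%R, s])
     (expR (- c * r) * (mu + lambda * bd_flow x (s - r) ^+ 2))%:E =
   (bd_flow x s - expR (- c * s) * x)%:E)%E.
Proof.
move=> x01; rewrite le_eqVlt => /predU1P[<-|s0].
  by rewrite set_itv1 integral_set1 bd_flow0 mulr0 expR0 mul1r subrr.
pose F r := - 1 * (expR (- c * r) * bd_flow x (s - r)).
have DF r : r <= s -> is_derive r 1 F (flow_integrand (bd_flow x) s r).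
  move=> rs.
  have DM := is_deriveM (is_derive_expRM (- c) r) (is_derive_flow_shift x01 rs).
  have := is_derive_affine 0 (-1) DM; under eq_fun do rewrite add0r.
  by move=> H; apply: (is_derive_eq H); rewrite /GRing.scale /= /flow_integrand; ring.
rewrite (@continuous_FTC2 _ (flow_integrand (bd_flow x) s) F)//.
- by rewrite -EFinD /F mulr0 expR0 subrr subr0 bd_flow0; congr EFin; ring.
- exact: continuous_flow_integrand.
- split.
  + by move=> r; rewrite in_itv /= => /andP[_ /ltW/DF ?]; exact: ex_derive.
  + by apply/cvg_at_right_filter; exact: (is_derive_continuous (DF _ (ltW s0))).
  + by apply/cvg_at_left_filter; exact: (is_derive_continuous (DF _ (lexx s))).
- by move=> r; rewrite in_itv /= => /andP[_ /ltW/DF ?]; rewrite derive1E derive_val.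
Qed.

(* Picard: a bound A exp(4 lambda s) on the difference of two bounded solutions
   improves to A / 2 exp(4 lambda s). *)
Lemma bd_flow_unique (h : R -> R) (x : R) : 0 <= x <= 1 ->
  measurable_fun setT h -> (forall s, 0 <= h s <= 1) ->
  (forall s, 0 <= s ->
    ((h s)%:E = (expR (- c * s) * x)%:E + \int[lebesgue_measure]_(r in `[0%R, s])
       (expR (- c * r) * (mu + lambda * h (s - r) ^+ 2))%:E)%E) ->
  forall s, 0 <= s -> h s = bd_flow x s.
Proof.
move=> x01 mh h01 hE.
pose K := 4 * lambda; have K0 : 0 < K by rewrite mulr_gt0.
have expB r : 0 <= r -> 0 <= expR (- c * r) <= 1.
  by move=> r0; rewrite expR_ge0/= -expR0 ler_expR mulNr oppr_le0 mulr_ge0.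
have step (A : R) : 0 <= A ->
    (forall s, 0 <= s -> `|h s - bd_flow x s| <= A * expR (K * s)) ->
    forall s, 0 <= s -> `|h s - bd_flow x s| <= A / 2 * expR (K * s).
  move=> A0 HA s s0.
  have [->|s_neq0] := eqVneq s 0.
    have := hE 0 (lexx _); rewrite set_itv1 integral_set1 adde0 mulr0 expR0 mul1r.
    by move=> [->]; rewrite bd_flow0 subrr normr0 mulr_ge0 ?divr_ge0 ?expR_ge0.
  have s_gt0 : 0 < s by rewrite lt_neqAle eq_sym s_neq0.
  have ih : lebesgue_measure.-integrable `[0, s] (EFin \o flow_integrand h s).
    apply: measurable_bounded_integrable => //.
    + by apply: compact_finite_measure; exact: segment_compact.
    + apply: measurable_funM.
        apply: measurable_funTS.
        by apply: measurableT_comp; [exact: measurable_expR|exact: mulrl_measurable].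
      apply: measurable_funD => //; apply: measurable_funM => //.
      apply: measurable_funX; apply: measurable_funTS; apply: measurableT_comp => //.
      exact: measurable_funB.
    + exists (mu + lambda); split; first exact: num_real.
      move=> M ltM r; rewrite /= in_itv/= => /andP[r0 rs].
      have /andP[e0 e1] := expB r r0; have /andP[h0 h1] := h01 (s - r).
      have h2 : h (s - r) ^+ 2 <= 1 by rewrite expr_le1.
      rewrite ger0_norm; last by rewrite mulr_ge0// addr_ge0// mulr_ge0 ?exprn_ge0// ltW.
      apply: le_trans (ltW ltM); rewrite -[leRHS]mul1r ler_pM//.
        by rewrite addr_ge0// mulr_ge0 ?exprn_ge0// ltW.
      by rewrite lerD2l ler_piMr// ltW.
  have iy : lebesgue_measure.-integrable `[0, s] (EFin \o flow_integrand (bd_flow x) s).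
    apply: continuous_compact_integrable; first exact: segment_compact.
    exact: continuous_flow_integrand.
  have -> : h s - bd_flow x s =
      \int[lebesgue_measure]_(r in `[0, s])
        (flow_integrand h s r - flow_integrand (bd_flow x) s r).
    rewrite RintegralB// /Rintegral bd_flow_integral//.
    have := hE s s0; rewrite -/(flow_integrand h s).
    have ihf : (\int[lebesgue_measure]_(r in `[0%R, s])
        (flow_integrand h s r)%:E)%E \is a fin_num by exact: integrable_fin_num.
    by rewrite -(fineK ihf) -EFinD => -[->] /=; ring.
  have iB : lebesgue_measure.-integrable `[0, s] (EFin \o
      (fun r => flow_integrand h s r - flow_integrand (bd_flow x) s r)).
    by rewrite (_ : _ \o _ = (EFin \o flow_integrand h s) \-
      (EFin \o flow_integrand (bd_flow x) s))%E//; exact: integrableB.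
  apply: (le_trans (le_normr_Rintegral _ iB)) => //.
  rewrite -lee_fin /Rintegral fineK; last first.
    by apply: integrable_fin_num => //; exact: (integrable_norm iB).
  (* As both solutions lie in [0, 1], their squares differ by at most twice their difference. For
     [K = 4 lambda] the resulting bound 2 lambda A exp (K (s - r)) is A / 2 exp (K s) times the
     exponential density of rate [K] at r, of mass at most 1. *)
  apply: (@le_trans _ _ (\int[lebesgue_measure]_(r in `[0%R, s])
     ((A / 2 * expR (K * s))%:E * (exponential_pdf K r)%:E))%E).
    have mpdf := measurable_exponential_pdf K.
    apply: ge0_le_integral => //.
    + apply: (measurable_int lebesgue_measure); exact: (integrable_norm iB).
    + apply/measurable_EFinP; apply: measurable_funM => //.
      exact: measurable_funTS.
    + move=> r; rewrite /= in_itv/= => /andP[r0 rs].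
      rewrite -EFinM lee_fin exponential_pdfE//.
      have sr0 : 0 <= s - r by rewrite subr_ge0.
      have /andP[e0 e1] := expB r r0; have /andP[h0 h1] := h01 (s - r).
      have /andP[y0 y1] := bd_flow_bounds x01 sr0.
      rewrite /flow_integrand -mulrBr normrM (ger0_norm e0).
      rewrite (_ : _ - _ = lambda * ((h (s - r) - bd_flow x (s - r)) *
        (h (s - r) + bd_flow x (s - r)))); last by ring.
      rewrite !normrM (gtr0_norm lambda_gt0).
      have n2 : `|h (s - r) + bd_flow x (s - r)| <= 2.
        by rewrite ger0_norm ?addr_ge0//; lra.
      have HAr := HA _ sr0.
      apply: (@le_trans _ _ (1 * (lambda * (A * expR (K * (s - r)) * 2)))).
        rewrite ler_pM ?mulr_ge0 ?(ltW lambda_gt0)// ler_wpM2l ?(ltW lambda_gt0)//.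
        by rewrite ler_pM.
      have -> : expR (K * (s - r)) = expR (K * s) * expR (- K * r).
        by rewrite -expRD; congr expR; ring.
      rewrite le_eqVlt; apply/orP; left; apply/eqP.
      by move: (expR _) (expR _) => e1' e2'; rewrite /K; field.
  have ge0pdf r : (0 <= (exponential_pdf K r)%:E)%E.
    by rewrite lee_fin exponential_pdf_ge0// ltW.
  rewrite ge0_integralZl//; last 2 first.
  - by apply/measurable_EFinP; apply: measurable_funTS; exact: measurable_exponential_pdf.
  - by rewrite lee_fin mulr_ge0 ?divr_ge0 ?expR_ge0.
  rewrite -[leRHS]mule1 lee_wpmul2l//.
    by rewrite lee_fin mulr_ge0 ?divr_ge0 ?expR_ge0.
  rewrite [leLHS](exponential_prob_itv0c K s_gt0) -EFinB lee_fin.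
  by rewrite gerBl expR_ge0.
move=> s s0; apply/eqP; rewrite -subr_eq0 -normr_le0.
(* The iteration starts from A = 1, since both functions have values in [0, 1]. *)
have bnd k : `|h s - bd_flow x s| <= 2^-1 ^+ k * expR (K * s).
  elim: k s s0 => [|k IH] s s0.
    rewrite expr0 mul1r.
    have /andP[h0 h1] := h01 s; have /andP[y0 y1] := bd_flow_bounds x01 s0.
    apply: (@le_trans _ _ 1); first by rewrite ler_norml; lra.
    by rewrite -expR0 ler_expR mulr_ge0// ltW.
  by rewrite exprSr; apply: step.
have L : (2^-1 : R) ^+ k * expR (K * s) @[k --> \oo] --> (0 * expR (K * s)).
  apply: cvgMr_tmp; apply: cvg_expr.
  by rewrite ger0_norm// invf_lt1// ltr1n.
rewrite -(mul0r (expR (K * s))) -(cvg_lim _ L)//.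
by apply: limr_ge; [exact: cvgP L|exact: nearW].
Qed.

End birth_death_flow.

(** * The branching property of independent marks *)

(** Listed as root, first subtree, second subtree, so that a product over [words k.+1] factors along
    a graft. *)
Fixpoint words (k : nat) : seq (seq bool) :=
  if k is k'.+1 then
    [::] :: [seq false :: u | u <- words k'] ++ [seq true :: u | u <- words k']
  else [::].

Lemma mem_words k u : (u \in words k) = (size u < k)%N.
Proof.
elim: k u => [|k IH] [|b u] //=.
have injc (c : bool) : injective (cons c) by move=> ? ? [].
rewrite in_cons /= mem_cat ltnS -IH; case: b.
  rewrite [X in _ || X](mem_map (injc true)).
  by rewrite (negbTE (_ : _ \notin _))//; apply/mapP => -[].
rewrite [X in X || _](mem_map (injc false)).
by rewrite orbC (negbTE (_ : _ \notin _))//; apply/mapP => -[].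
Qed.

Lemma uniq_words k : uniq (words k).
Proof.
have injc (c : bool) : injective (cons c) by move=> ? ? [].
elim: k => //= k IH; rewrite mem_cat cat_uniq !(map_inj_uniq (injc _)) IH /= andbT.
apply/andP; split; first by apply/orP => -[] /mapP[].
by apply/hasPn => _ /mapP[u _ ->]; apply/mapP => -[].
Qed.

Section branching.
Context {R : realType} (Q : probability (@tree_space R) R)
  (E : probability R R) (B : probability bool R).

(** Values on cylinders alone; by [tree_measure_unique] they determine [Q]. *)
Definition iid_marks := forall (A : seq bool -> set R) (C : seq bool -> set bool) k,
  (forall u, measurable (A u)) ->
  (forall u, (k <= size u)%N -> A u = setT /\ C u = setT) ->
  Q (tree_cylinder A C) = (\prod_(u <- words k) (E (A u) * B (C u)))%E.

Hypothesis QE : iid_marks.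

Let graft_pair (y : (R * bool) * (@tree_space R * @tree_space R)) : @tree_space R :=
  graft y.1 y.2.1 y.2.2.

Let markP : probability (R * bool)%type R := (E \x B)%E.

Let subtreeP : probability (@tree_space R * @tree_space R)%type R := (Q \x Q)%E.

Let measurable_graft_pair : measurable_fun setT graft_pair.
Proof.
apply: measurable_graft => //.
  exact: (measurableT_comp measurable_fst measurable_snd).
exact: (measurableT_comp measurable_snd measurable_snd).
Qed.

Let pair_law : probability (@tree_space R) R :=
  distribution (markP \x subtreeP)%E
    (HB.pack graft_pair (isMeasurableFun.Build _ _ _ _ _ measurable_graft_pair)
      : {mfun _ >-> _}).

(** Self-similarity: two independent trees grafted on an independent root mark have the law of the
    tree. On cylinders this is a factorization, since the preimage of a cylinder under grafting is a
    rectangle. *)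
Let pair_lawE (S : set (@tree_space R)) : measurable S -> Q S = pair_law S.
Proof.
apply: tree_measure_unique => _ [A [C [mA [k AC] ->]]].
(* The depth is raised by one so that [words] splits into the root and two copies of [words k], even
   when [k] is 0. *)
rewrite (QE mA (k := k.+1)); last by move=> u /ltnW; exact: AC.
pose A' b u := A (b :: u); pose C' b u := C (b :: u).
have mc b : measurable (tree_cylinder (A' b) (C' b) : set (@tree_space R)).
  apply: sub_sigma_algebra; exists (A' b), (C' b); split => //.
    by move=> u; exact: mA.
  by exists k => u ku; apply: AC; rewrite (leq_trans ku).
rewrite /= big_cons big_cat !big_map /=.
rewrite -(QE (A := A' false) (C := C' false))//; last 2 first.
- by move=> u; exact: mA.
- by move=> u ku; apply: AC; rewrite (leq_trans ku).
rewrite -(QE (A := A' true) (C := C' true))//; last 2 first.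
- by move=> u; exact: mA.
- by move=> u ku; apply: AC; rewrite (leq_trans ku).
rewrite /pair_law /distribution /pushforward /=.
rewrite (_ : _ @^-1` _ = (A [::] `*` C [::]) `*`
  (tree_cylinder (A' false) (C' false) `*` tree_cylinder (A' true) (C' true))).
  apply/esym; etransitivity.
    by apply: (@product_measure1E _ _ _ _ _ markP subtreeP); exact: measurableX.
  by congr (_ * _)%E; exact: product_measure1E.
apply/seteqP; split => [[x [w0 w1]]|[x [w0 w1]]] /=.
  move=> H; split; first exact: (H [::]).
  by split=> u; [exact: (H (false :: u))|exact: (H (true :: u))].
by move=> [H [H0 H1]] [|[] u]; [exact: H|exact: H1|exact: H0].
Qed.

Lemma branching_integral (p : R) (F : @tree_space R -> \bar R) : 0 <= p <= 1 ->
  (forall S, B S = bernoulli_prob p S) ->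
  measurable_fun setT F -> (forall w, 0 <= F w)%E ->
  (\int[Q]_w F w = \int[E]_r
    (p%:E * \int[Q \x Q]_y F (graft (r, true) y.1 y.2) +
     (1 - p)%:E * \int[Q \x Q]_y F (graft (r, false) y.1 y.2)))%E.
Proof.
move=> p01 BE mF F0.
transitivity (\int[pair_law]_w F w)%E.
  by apply: eq_measure_integral => S mS _; exact: pair_lawE.
rewrite ge0_integral_pushforward// preimage_setT.
have mFg := measurableT_comp mF measurable_graft_pair.
rewrite (@fubini_tonelli1 _ _ _ _ _ markP subtreeP (F \o graft_pair))//; last first.
  by move=> y; exact: F0.
rewrite (@fubini_tonelli1 _ _ _ _ _ E B)//; last 2 first.
- by apply: measurable_fun_fubini_tonelli_F => // y; exact: F0.
- by move=> x; rewrite /fubini_F; apply: integral_ge0 => y _; exact: F0.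
apply: eq_integral => r _; rewrite /fubini_F /=.
rewrite -[RHS](integral_bernoulli_prob (p := p) p01
  (f := fun b => \int[Q \x Q]_y F (graft (r, b) y.1 y.2))%E)//; last first.
  by move=> b; exact: integral_ge0.
by apply: eq_measure_integral => S _ _; exact: BE.
Qed.

Lemma integral_product (g : @tree_space R -> \bar R) :
  measurable_fun setT g -> (forall w, 0 <= g w)%E ->
  (\int[Q \x Q]_y (g y.1 * g y.2) = (\int[Q]_w g w) * (\int[Q]_w g w))%E.
Proof.
move=> mg g0; rewrite fubini_tonelli1//; last 2 first.
- apply: emeasurable_funM; first exact: (measurableT_comp mg measurable_fst).
  exact: (measurableT_comp mg measurable_snd).
- by move=> y; exact: mule_ge0.
rewrite -ge0_integralZr//; last exact: integral_ge0.
by apply: eq_integral => w _; rewrite /fubini_F /= ge0_integralZl.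
Qed.

End branching.

(** * Nonnegative power series and identification of their coefficients *)

Section nonnegative_series.
Context {R : realType}.
Implicit Types (p q f : nat -> R) (z b : R).

Lemma nneseries_EFin_lim f (g : nat -> R) (l : R) :
  (forall n, \sum_(0 <= k < n) f k = g n) -> g @ \oo --> l ->
  (\sum_(0 <= k <oo) (f k)%:E)%E = l%:E.
Proof.
move=> fg gl; apply/cvg_lim => //.
rewrite (_ : (fun _ => _) = EFin \o g); first exact/cvg_EFin/gl/nearW.
by apply/funext => n /=; rewrite sumEFin fg.
Qed.

Lemma geometric_nneseries z : 0 <= z < 1 ->
  (\sum_(0 <= k <oo) (z ^+ k)%:E)%E = ((1 - z)^-1)%:E.
Proof.
move=> /andP[z0 z1].
apply: (@nneseries_EFin_lim _ (series (geometric 1 z))).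
  by move=> n; apply: eq_bigr => k _; rewrite /geometric /= mul1r.
rewrite -[X in _ --> X]mul1r; apply: cvg_geometric_series.
by rewrite ger0_norm.
Qed.

(** Shifting the index gives S = 1 / (1 - z) + z S, which determines S only once S is known to be
    finite; an explicit formula for the partial sums bounds them first. *)
Lemma derived_geometric_nneseries z : 0 <= z < 1 ->
  (\sum_(0 <= k <oo) (k%:R * z ^+ k.-1)%:E)%E = (((1 - z) ^+ 2)^-1)%:E.
Proof.
move=> /andP[z0 z1].
have z'0 : 0 < 1 - z by rewrite subr_gt0.
have z'n0 : 1 - z != 0 by rewrite gt_eqF.
have f0 n : (0 <= (n%:R * z ^+ n.-1)%:E)%E.
  by rewrite lee_fin mulr_ge0 ?exprn_ge0.
set S := (LHS).
have S0 : (0 <= S)%E by exact: nneseries_ge0.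
have leS : (S <= (((1 - z) ^+ 2)^-1)%:E)%E.
  apply: lime_le; first exact: is_cvg_nneseries.
  apply: nearW => n; rewrite sumEFin lee_fin.
  case: n => [|n]; first by rewrite big_nil invr_ge0 exprn_ge0// ltW.
  rewrite -(ler_pM2r (exprn_gt0 2 z'0)) mulVf ?expf_neq0//.
  suff -> : (\sum_(0 <= i < n.+1) i%:R * z ^+ i.-1) * (1 - z) ^+ 2 =
            1 - z ^+ n * (1 + n%:R * (1 - z)).
    by rewrite gerBl mulr_ge0 ?exprn_ge0// addr_ge0// mulr_ge0// ltW.
  elim: n => [|n IH]; first by rewrite big_nat1 !mul0r expr0 mul1r addr0 subrr.
  by rewrite big_nat_recr//= mulrDl IH -natr1 [z ^+ n.+1]exprS; ring.
have Sfin : S \is a fin_num by rewrite ge0_fin_numE// (le_lt_trans leS) ?ltry.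
have : S = (((1 - z)^-1)%:E + z%:E * S)%E.
  rewrite -geometric_nneseries ?z0// -nneseriesZl// -nneseriesD//; last 2 first.
  - by move=> i _ _; rewrite lee_fin exprn_ge0.
  - by move=> i _ _; rewrite mule_ge0.
  rewrite [LHS]nneseries_recl//= mul0r add0e -nneseries_addn//.
  apply: eq_eseriesr => i _.
  rewrite addn1 /= -EFinD; congr EFin; case: i => [|i] /=; first by ring.
  by rewrite -!natr1 [z ^+ i.+1]exprS; ring.
rewrite -(fineK Sfin) -EFinM -EFinD => -[Se]; congr EFin.
apply: (mulIf (expf_neq0 2 z'n0)); rewrite mulVf ?expf_neq0//.
have : fine S * (1 - z) = (1 - z)^-1 by rewrite mulrBr mulr1 {1}Se; ring.
by rewrite expr2 mulrA => ->; rewrite mulVf.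
Qed.

Lemma ler_limit0 (x y C b0 : R) : 0 < b0 ->
  (forall b, 0 < b <= b0 -> x <= y + b * C) -> x <= y.
Proof.
move=> b00 H; apply/ler_addgt0Pr => e e0.
pose b := Num.min b0 (e / (`|C| + 1)).
have C0 : 0 < `|C| + 1 by rewrite ltr_pwDr.
have b0' : 0 < b by rewrite lt_min b00 divr_gt0.
apply: le_trans (H b _) _; first by rewrite b0' ge_min lexx.
rewrite lerD2l; apply: (@le_trans _ _ (b * (`|C| + 1))).
  by rewrite ler_pM2l// (le_trans (ler_norm C))// lerDl.
by rewrite -ler_pdivlMr// ge_min lexx orbT.
Qed.

(** Strong induction on the index: the lower terms agree and are subtracted, the rest is divided by
    b ^ n, and b tends to 0. The argument [aux] gives one inequality and is applied in both
    directions. *)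
Lemma nneseries_coef_inj p q (b0 : R) : 0 < b0 ->
  (forall n, 0 <= p n) -> (forall n, 0 <= q n) ->
  (forall b, 0 < b <= b0 ->
    (\sum_(0 <= n <oo) (p n * b ^+ n)%:E =
     \sum_(0 <= n <oo) (q n * b ^+ n)%:E)%E) ->
  (\sum_(0 <= n <oo) (q n * b0 ^+ n)%:E < +oo)%E ->
  p =1 q.
Proof.
move=> b00; have b0n0 : b0 != 0 by rewrite gt_eqF.
have aux p' q' n : (forall n, 0 <= p' n) -> (forall n, 0 <= q' n) ->
    (forall b, 0 < b <= b0 ->
      (\sum_(0 <= n <oo) (p' n * b ^+ n)%:E =
       \sum_(0 <= n <oo) (q' n * b ^+ n)%:E)%E) ->
    (\sum_(0 <= n <oo) (q' n * b0 ^+ n)%:E < +oo)%E ->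
    (forall i, (i < n)%N -> p' i = q' i) -> p' n <= q' n.
  move=> p0 q0 pq qoo pqn.
  have t0 (r : nat -> R) b : (forall n, 0 <= r n) -> 0 <= b ->
      forall k, (0 <= (r k * b ^+ k)%:E)%E.
    by move=> r0 b0' k; rewrite lee_fin mulr_ge0 ?exprn_ge0.
  set T := (\sum_(n.+1 <= k <oo) (q' k * b0 ^+ k)%:E)%E.
  have Toe : T \is a fin_num.
    rewrite ge0_fin_numE; last by apply: nneseries_ge0 => k _ _; exact/t0/ltW.
    apply: le_lt_trans qoo.
    rewrite [leRHS](@nneseries_split _ _ 0%N n.+1); last by move=> k _; exact/t0/ltW.
    by rewrite add0n leeDr// sume_ge0// => k _; exact/t0/ltW.
  apply: (@ler_limit0 _ _ (fine T / b0 ^+ n.+1) b0) => // b bb0.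
  have /andP[b_gt0 b_le] := bb0.
  have tail : (\sum_(n <= k <oo) (p' k * b ^+ k)%:E =
               \sum_(n <= k <oo) (q' k * b ^+ k)%:E)%E.
    have := pq b bb0.
    rewrite (@nneseries_split _ _ 0%N n); last by move=> k _; exact/t0/ltW.
    rewrite [RHS](@nneseries_split _ _ 0%N n); last by move=> k _; exact/t0/ltW.
    rewrite add0n (@eq_big_nat _ _ _ _ _ _ (fun k => (q' k * b ^+ k)%:E)).
      rewrite sumEFin => /(congr1 (fun x => x - (\sum_(0 <= i < n) q' i * b ^+ i)%:E)%E).
      by rewrite ![((_)%:E + _)%E]addeC !addeK.
    by move=> i /andP[_ /pqn ->].
  (* Every index beyond n satisfies b ^ k <= (b / b0) ^ (n + 1) b0 ^ k, so the tail at b is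
     controlled by the finite tail [T] at [b0]. After division by b ^ n it is of order b. *)
  have : ((p' n * b ^+ n)%:E <= (q' n * b ^+ n)%:E + ((b / b0) ^+ n.+1)%:E * T)%E.
    apply: (@le_trans _ _ (\sum_(n <= k <oo) (p' k * b ^+ k)%:E)%E).
      rewrite (@nneseries_split _ _ n 1%N); last by move=> k _; exact/t0/ltW.
      rewrite addn1 big_nat1 leeDl// nneseries_ge0// => k _ _; exact/t0/ltW.
    rewrite tail (@nneseries_split _ _ n 1%N); last by move=> k _; exact/t0/ltW.
    rewrite addn1 big_nat1 leeD2l// -nneseriesZl; last first.
      by move=> k _; exact/t0/ltW.
    rewrite -[leLHS]nneseries_addn; last by move=> i; exact/t0/ltW.
    rewrite -[leRHS]nneseries_addn; last first.
      move=> i; apply: mule_ge0; last exact/t0/ltW.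
      by rewrite lee_fin exprn_ge0// divr_ge0// ltW.
    apply: lee_nneseries => [i _ _|i _]; first exact/t0/ltW.
    rewrite -EFinM lee_fin mulrCA ler_wpM2l//.
    rewrite [b0 ^+ _]exprD mulrCA -exprMn divfK// exprD ler_wpM2r ?exprn_ge0 ?(ltW b_gt0)//.
    by rewrite lerXn2r ?nnegrE ?(ltW b_gt0) ?(ltW b00).
  rewrite -(fineK Toe) -EFinM -EFinD lee_fin => H.
  rewrite -(ler_pM2r (exprn_gt0 n b_gt0)) (le_trans H)//.
  rewrite mulrDl lerD2l expr_div_n [b ^+ n.+1]exprS le_eqVlt.
  by apply/orP; left; apply/eqP; ring.
move=> p0 q0 pq qoo n; elim/ltn_ind: n => n IH.
apply/eqP; rewrite eq_le; apply/andP; split; first exact: aux.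
apply: aux => //; first by move=> b bb; rewrite pq.
  by rewrite pq// b00 lexx.
by move=> i /IH.
Qed.

End nonnegative_series.

(** * Weights whose means are the generating functions *)

Section generating_weight.
Context {R : realType}.

(** Power with an extended exponent. An infinite count has weight 0 even for b = 1; and since 0 to
    the power 0 is 1, [gpow 0] is the indicator of extinction. *)
Definition gpow (b : R) (x : \bar R) : R := if x is r%:E then b `^ r else 0.

Definition is_count (x : \bar R) := x = +oo%E \/ exists n, x = n%:R%:E.

Lemma gpow_nat (b : R) n : 0 <= b -> gpow b n%:R%:E = b ^+ n.
Proof. exact: powR_mulrn. Qed.

Lemma gpowD (b : R) (x y : \bar R) : 0 <= b -> is_count x -> is_count y ->
  gpow b (x + y)%E = gpow b x * gpow b y.
Proof.
move=> b0 [->|[n ->]] [->|[m ->]] //; rewrite ?addye ?addey//=; rewrite ?mul0r ?mulr0//.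
by rewrite -natrD !powR_mulrn// exprD.
Qed.

Lemma gpow_bounds (b : R) (x : \bar R) : 0 <= b <= 1 -> is_count x ->
  0 <= gpow b x <= 1.
Proof.
move=> /andP[b0 b1] [->|[n ->]]; first by rewrite /= lexx ler01.
by rewrite gpow_nat// exprn_ge0// exprn_ile1.
Qed.

Lemma measurable_gpow (b : R) : measurable_fun setT (gpow b).
Proof.
rewrite (_ : gpow b = fun x => if x \is a fin_num then b `^ fine x else 0); last first.
  by apply/funext => -[].
apply: measurable_fun_ifT => //.
  apply: (measurable_fun_bool true) => //.
  exact: (@emeasurable_fin_num _ _ _ setT id).
exact: (measurableT_comp (measurable_powRr b) (fine_measurable measurableT)).
Qed.

Lemma nb_ancestral_count s t (w : seq bool -> R * bool) : is_count (nb_ancestral s t w).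
Proof. exact: countingP. Qed.

Definition weight (a b s t : R) (w : @tree_space R) : R :=
  gpow a (nb_ancestral s t w) * gpow b (nb_ancestral t t w).

Lemma weight_bounds a b s t w : 0 <= a <= 1 -> 0 <= b <= 1 ->
  0 <= weight a b s t w <= 1.
Proof.
move=> a01 b01.
have /andP[A0 A1] := gpow_bounds a01 (nb_ancestral_count s t w).
have /andP[B0 B1] := gpow_bounds b01 (nb_ancestral_count t t w).
by rewrite mulr_ge0//= mulr_ile1.
Qed.

Lemma measurable_weight a b d (X : measurableType d) (S U : X -> R) (W : X -> @tree_space R) :
  measurable_fun setT S -> measurable_fun setT U -> measurable_fun setT W ->
  measurable_fun setT (fun x => weight a b (S x) (U x) (W x)).
Proof.
move=> mS mU mW; apply: measurable_funM.
  exact: (measurableT_comp (measurable_gpow a) (measurable_nb_ancestral mS mU mW)).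
exact: (measurableT_comp (measurable_gpow b) (measurable_nb_ancestral mU mU mW)).
Qed.

Lemma weight_graft a b s t x w0 w1 : 0 <= a -> 0 <= b -> x.1 <= s -> s <= t ->
  weight a b s t (graft x w0 w1) =
  if x.2 then weight a b (s - x.1) (t - x.1) w0 * weight a b (s - x.1) (t - x.1) w1
  else 1.
Proof.
move=> a0 b0 xs st; rewrite /weight !nb_ancestral_graft ?(le_trans xs)//.
case: ifP => _; last by rewrite /= !powRr0 mulr1.
rewrite !gpowD//; try exact: nb_ancestral_count.
by rewrite mulrACA.
Qed.

(** What [weight] becomes while the root is alive, the first count being then 0 or 1. Writing it as
    this combination makes its mean affine in a. *)
Definition leaf_weight (a b t : R) (w : @tree_space R) : R :=
  (1 - a) * gpow 0 (nb_ancestral t t w) + a * gpow b (nb_ancestral t t w).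

Lemma weight_graft_root a b s t x w0 w1 : 0 <= a -> 0 <= b ->
  nonneg_tree w0 -> nonneg_tree w1 -> 0 <= s < x.1 -> s <= t ->
  weight a b s t (graft x w0 w1) =
  leaf_weight a b (t - s) (graft (x.1 - s, x.2) w0 w1).
Proof.
move=> a0 b0 w00 w10 sx st; have /andP[s0 _] := sx.
rewrite /weight /leaf_weight -nb_ancestral_graft_shift ?s0//.
rewrite nb_ancestral_graft_root//.
have := nb_ancestral_count t t (graft x w0 w1).
move: (nb_ancestral t t (graft x w0 w1)) => N [->|[n ->]].
  by rewrite /= !mulr0 addr0.
rewrite !gpow_nat// eqe pnatr_eq0; case: n => [|n] /=.
  by rewrite powRr0 !expr0 !mulr1 subrK.
by rewrite powRr1// expr0n /= mulr0 add0r.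
Qed.

Lemma measurable_leaf_weight a b t : measurable_fun setT (leaf_weight a b t).
Proof.
have mN : measurable_fun setT (fun w : @tree_space R => nb_ancestral t t w).
  exact: measurable_nb_ancestral.
apply: measurable_funD; apply: measurable_funM => //.
  exact: (measurableT_comp (measurable_gpow 0) mN).
exact: (measurableT_comp (measurable_gpow b) mN).
Qed.

Lemma leaf_weight_bounds a b t w : 0 <= a <= 1 -> 0 <= b <= 1 ->
  0 <= leaf_weight a b t w <= 1.
Proof.
move=> /andP[a0 a1] b01.
have z01 : 0 <= (0 : R) <= 1 by rewrite lexx ler01.
have /andP[A0 A1] := gpow_bounds z01 (nb_ancestral_count t t w).
have /andP[B0 B1] := gpow_bounds b01 (nb_ancestral_count t t w).
rewrite /leaf_weight; apply/andP; split; nra.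
Qed.

End generating_weight.

(** * The integral equation and the generating function *)

Section generating_function.
Context {R : realType} (Q : probability (@tree_space R) R)
  (E : probability R R) (B : probability bool R) (lambda mu : R).
Hypotheses (lambda_gt0 : 0 < lambda) (mu_ge0 : 0 <= mu) (mu_le : mu <= lambda).
Hypothesis QE : iid_marks Q E B.
Let c := lambda + mu.
Let p := lambda / c.
Hypothesis EE : forall A : set R, measurable A -> E A = exponential_prob c A.
Hypothesis BE : forall S, B S = bernoulli_prob p S.

Let c_gt0 : 0 < c. Proof. by rewrite ltr_pwDl. Qed.

Let p01 : 0 <= p <= 1.
Proof.
rewrite divr_ge0 ?(ltW lambda_gt0) ?(ltW c_gt0)//=.
by rewrite ler_pdivrMr// mul1r lerDl.
Qed.

Lemma exponential_law_ge0 : E `[0, +oo[%classic = 1%E.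
Proof.
have mI : measurable (`[0, +oo[%classic : set R) by exact: measurable_itv.
rewrite -(setIT `[0, +oo[%classic) -(integral_indic _ _ mI)//=.
rewrite (integral_exponential_law c_gt0 EE)//; last 2 first.
- by apply/measurable_EFinP; exact: measurable_indic.
- by move=> x; rewrite indicE; case: (_ \in _); rewrite !lee_fin ?lexx ?ler01.
rewrite -(integral_exponential_pdf c_gt0) integral_mkcond [RHS]integral_mkcond.
apply: eq_integral => x _; rewrite !patchE /exponential_pdf patchE in_setT.
by case: ifPn => // xI; rewrite indicE xI mul1e.
Qed.

(** The nonnegative trees are the countable intersection of the cylinders [D k], each of probability
    1. *)
Lemma nonneg_tree_ae : Q.-negligible (~` [set w | nonneg_tree w]).
Proof.
have mn := @measurable_nonneg_tree R.
pose D k : set (@tree_space R) :=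
  tree_cylinder (fun u => if (size u < k)%N then `[0, +oo[%classic else setT) (fun=> setT).
have mD k : measurable (D k).
  apply: sub_sigma_algebra.
  exists (fun u => if (size u < k)%N then `[0, +oo[%classic else setT), (fun=> setT).
  split => //.
    by move=> u; case: ifP => // _; exact: measurable_itv.
  by exists k => u ku; rewrite ltnNge ku.
have QD k : Q (D k) = 1%E.
  rewrite (QE (k := k)); last 2 first.
  - by move=> u; case: ifP => // _; exact: measurable_itv.
  - by move=> u ku; rewrite ltnNge ku.
  rewrite big_seq big1// => u; rewrite mem_words => ->.
  by rewrite exponential_law_ge0 probability_setT mule1.
have -> : ~` [set w | nonneg_tree w] = \bigcup_k ~` D k.
  rewrite -setC_bigcap; congr setC; apply/seteqP; split => w /= H.
    by move=> k _ u /=; split => //; case: ifP => // _; rewrite /= in_itv/= andbT.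
  move=> u; have [+ _] := H (size u).+1 Logic.I u.
  by rewrite /= ltnSn /= in_itv/= andbT.
apply: negligible_bigcup => k.
apply/negligibleP; first exact: measurableC.
by have := probability_setC Q (mD k); rewrite QD subee.
Qed.

Definition pgf (a b s t : R) : R := fine (\int[Q]_w (weight a b s t w)%:E).

Let measurable_weightQ a b s t : measurable_fun setT (@weight R a b s t).
Proof.
exact: (@measurable_weight _ a b _ _ (cst s) (cst t) id).
Qed.

Let integral_bounds (F : @tree_space R -> R) : measurable_fun setT F ->
  (forall w, 0 <= F w <= 1) -> (0 <= \int[Q]_w (F w)%:E <= 1)%E.
Proof.
move=> mF F01; apply/andP; split.
  by apply: integral_ge0 => w _; rewrite lee_fin; have /andP[] := F01 w.
rewrite -(probability_setT Q) -[X in (_ <= X)%E]mul1e -integral_cst//.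
apply: ge0_le_integral => //.
- by move=> w _; rewrite lee_fin; have /andP[] := F01 w.
- exact/measurable_EFinP.
- by move=> w _; rewrite lee_fin; have /andP[] := F01 w.
Qed.

Lemma pgfE a b s t : 0 <= a <= 1 -> 0 <= b <= 1 ->
  (\int[Q]_w (weight a b s t w)%:E = (pgf a b s t)%:E)%E.
Proof.
move=> a01 b01; rewrite /pgf fineK//.
have /andP[I0 I1] : (0 <= \int[Q]_w (weight a b s t w)%:E <= 1)%E.
  apply: integral_bounds => [|w]; last exact: weight_bounds.
  exact: measurable_weightQ.
by rewrite ge0_fin_numE// (le_lt_trans I1)// ltry.
Qed.

Lemma pgf_bounds a b s t : 0 <= a <= 1 -> 0 <= b <= 1 -> 0 <= pgf a b s t <= 1.
Proof.
move=> a01 b01; rewrite -!lee_fin -pgfE//.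
apply: integral_bounds => [|w]; last exact: weight_bounds.
exact: measurable_weightQ.
Qed.

Lemma measurable_pgf a b tau : 0 <= a <= 1 -> 0 <= b <= 1 ->
  measurable_fun setT (fun s => pgf a b s (s + tau)).
Proof.
move=> a01 b01; apply/measurable_EFinP.
have -> : EFin \o (fun s => pgf a b s (s + tau)) =
    fubini_F Q (fun y : R * @tree_space R => (weight a b y.1 (y.1 + tau) y.2)%:E).
  by apply/funext => s; rewrite /= -pgfE.
apply: measurable_fun_fubini_tonelli_F.
  apply/measurable_EFinP; apply: measurable_weight; first exact: measurable_fst.
    by apply: measurable_funD => //; exact: measurable_fst.
  exact: measurable_snd.
by move=> y; rewrite lee_fin; have /andP[] := weight_bounds y.1 (y.1 + tau) y.2 a01 b01.
Qed.

Let subtreeP : probability (@tree_space R * @tree_space R)%type R := (Q \x Q)%E.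

(** Mean of [F] given that the root event happens at time r. *)
Let subtree_mean (F : @tree_space R -> \bar R) (r : R) : \bar R :=
  (p%:E * \int[Q \x Q]_y F (graft (r, true) y.1 y.2) +
   (1 - p)%:E * \int[Q \x Q]_y F (graft (r, false) y.1 y.2))%E.

Let measurable_subtree_mean F : measurable_fun setT F -> (forall w, 0 <= F w)%E ->
  measurable_fun setT (subtree_mean F).
Proof.
move=> mF F0.
have mz z : measurable_fun setT (fun r => \int[Q \x Q]_y F (graft (r, z) y.1 y.2))%E.
  apply: (@measurable_fun_fubini_tonelli_F _ _ _ _ _ subtreeP
    (fun x : R * (@tree_space R * @tree_space R) => F (graft (x.1, z) x.2.1 x.2.2))) => //.
  apply: (measurableT_comp mF); apply: measurable_graft.
  - by apply: measurable_fun_pair; [exact: measurable_fst|exact: measurable_cst].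
  - exact: (measurableT_comp measurable_fst measurable_snd).
  - exact: (measurableT_comp measurable_snd measurable_snd).
by apply: emeasurable_funD; apply: measurable_funeM; exact: mz.
Qed.

Let subtree_mean_bounds (F : @tree_space R -> R) r : measurable_fun setT F ->
  (forall w, 0 <= F w <= 1) -> (0 <= subtree_mean (EFin \o F) r <= 1)%E.
Proof.
move=> mF F01.
have [p0 p1] : 0 <= p /\ 0 <= 1 - p by have /andP[? ?] := p01; rewrite subr_ge0.
have b z : (0 <= \int[Q \x Q]_y (EFin \o F) (graft (r, z) y.1 y.2) <= 1)%E.
  have m : measurable_fun setT (fun y : @tree_space R * @tree_space R =>
      (EFin \o F) (graft (r, z) y.1 y.2)).
    have mEF : measurable_fun setT (EFin \o F) by exact/measurable_EFinP.
    apply: (measurableT_comp mEF).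
    by apply: measurable_graft; [|exact: measurable_fst|exact: measurable_snd].
  apply/andP; split.
    by apply: integral_ge0 => w _; rewrite lee_fin; have /andP[] := F01 (graft (r, z) w.1 w.2).
  rewrite -(probability_setT (Q \x Q)%E) -[X in (_ <= X)%E]mul1e -integral_cst//.
  apply: ge0_le_integral => //.
  - by move=> w _; rewrite lee_fin; have /andP[] := F01 (graft (r, z) w.1 w.2).
  - by move=> w _; rewrite lee_fin; have /andP[] := F01 (graft (r, z) w.1 w.2).
have /andP[t0 t1] := b true; have /andP[f0 f1] := b false.
rewrite /subtree_mean adde_ge0 ?mule_ge0 ?lee_fin//=.
apply: (@le_trans _ _ (p%:E + (1 - p)%:E)%E).
  by apply: leeD; [rewrite -[leRHS]mule1|rewrite -[leRHS]mule1]; rewrite lee_wpmul2l.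
by rewrite -EFinD addrC subrK.
Qed.

Let branching (F : @tree_space R -> R) : measurable_fun setT F ->
  (forall w, 0 <= F w <= 1) ->
  (\int[Q]_w (F w)%:E = \int[lebesgue_measure]_(r in `[0%R, +oo[)
     (subtree_mean (EFin \o F) r * (c * expR (- c * r))%:E))%E.
Proof.
move=> mF F01.
have F0 w : (0 <= (F w)%:E)%E by rewrite lee_fin; have /andP[] := F01 w.
rewrite (branching_integral QE p01 BE)//; last exact/measurable_EFinP.
rewrite (integral_exponential_law c_gt0 EE)//.
- by apply: (@measurable_subtree_mean (EFin \o F)) => //; exact/measurable_EFinP.
- by move=> r; exact: (subtree_mean_bounds r mF F01).
Qed.

Let subtree_nonneg_ae :
  subtreeP.-negligible (~` [set y | nonneg_tree y.1 /\ nonneg_tree y.2]).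
Proof.
have mn := measurableC (@measurable_nonneg_tree R).
have Q0 : Q (~` [set w | nonneg_tree w]) = 0%E.
  by apply: measure_negligible => //; exact: nonneg_tree_ae.
have H : subtreeP.-negligible ((~` [set w | nonneg_tree w]) `*` setT `|`
                               setT `*` (~` [set w | nonneg_tree w])).
  apply: negligibleU; (apply/negligibleP; first exact: measurableX).
    transitivity (Q (~` [set w | nonneg_tree w]) * Q setT)%E; last by rewrite Q0 mul0e.
    exact: product_measure1E.
  transitivity (Q setT * Q (~` [set w | nonneg_tree w]))%E; last by rewrite Q0 mule0.
  exact: product_measure1E.
by apply: negligibleS H => y /= /not_andP[H|H]; [left|right].
Qed.

Let measurable_on_graft (F : @tree_space R -> R) x : measurable_fun setT F ->
  measurable_fun setT (fun y : @tree_space R * @tree_space R => (F (graft x y.1 y.2))%:E).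
Proof.
move=> mF; have mEF : measurable_fun setT (EFin \o F) by exact/measurable_EFinP.
apply: (measurableT_comp mEF).
by apply: measurable_graft; [|exact: measurable_fst|exact: measurable_snd].
Qed.

Let subtree_mean_root a b s t r : 0 <= a <= 1 -> 0 <= b <= 1 -> 0 <= s < r -> s <= t ->
  subtree_mean (EFin \o weight a b s t) r =
  subtree_mean (EFin \o leaf_weight a b (t - s)) (r - s).
Proof.
move=> a01 b01 sr st; have /andP[a0 _] := a01; have /andP[b0 _] := b01.
have z x : (\int[Q \x Q]_y (weight a b s t (graft (r, x) y.1 y.2))%:E =
    \int[Q \x Q]_y (leaf_weight a b (t - s) (graft (r - s, x) y.1 y.2))%:E)%E.
  apply: (@ge0_ae_eq_integral _ _ _ subtreeP) => //.
  - exact: measurable_on_graft.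
  - by apply: measurable_on_graft; exact: measurable_leaf_weight.
  - move=> y _; rewrite lee_fin.
    by have /andP[] := weight_bounds s t (graft (r, x) y.1 y.2) a01 b01.
  - move=> y _; rewrite lee_fin.
    by have /andP[] := leaf_weight_bounds (t - s) (graft (r - s, x) y.1 y.2) a01 b01.
  apply: negligibleS subtree_nonneg_ae => y /= + [y1 y2]; apply => _.
  by rewrite (@weight_graft_root _ a b s t (r, x)).
by rewrite /subtree_mean /= !z.
Qed.

(** After a split the counts of the two subtrees add up, so the weight is a product of independent
    factors with the same law; after a death all counts are 0 and the weight is 1. *)
Let subtree_mean_split a b s t r : 0 <= a <= 1 -> 0 <= b <= 1 -> r <= s <= t ->
  subtree_mean (EFin \o weight a b s t) r =
  (p * pgf a b (s - r) (t - r) ^+ 2 + (1 - p))%:E.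
Proof.
move=> a01 b01 /andP[rs st]; have /andP[a0 _] := a01; have /andP[b0 _] := b01.
rewrite /subtree_mean /=.
under eq_integral do rewrite weight_graft// EFinM.
rewrite (@integral_product _ Q (EFin \o weight a b (s - r) (t - r)))//; last 2 first.
- exact/measurable_EFinP.
- by move=> w; rewrite lee_fin; have /andP[] := weight_bounds (s - r) (t - r) w a01 b01.
under [X in (_ + _ * X)%E]eq_integral do rewrite weight_graft//.
have one : (\int[Q \x Q]_(y in setT) 1%:E = 1)%E.
  transitivity (1%:E * subtreeP setT)%E; last by rewrite probability_setT mule1.
  exact: (integral_cst subtreeP measurableT).
rewrite pgfE// one.
by rewrite !mule1 -!EFinM -EFinD expr2.
Qed.

(** Conditioning on the time r of the root event. If r > s, translation by s extracts exp (- c s)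
    and restarts the root at time 0 with lag t - s. If r <= s, the rates appear through c p = lambda
    and c (1 - p) = mu. *)
Lemma pgf_integral_equation a b s t : 0 <= a <= 1 -> 0 <= b <= 1 -> 0 <= s <= t ->
  ((pgf a b s t)%:E =
   (expR (- c * s))%:E * \int[Q]_w (leaf_weight a b (t - s) w)%:E +
   \int[lebesgue_measure]_(r in `[0%R, s])
     (expR (- c * r) * (mu + lambda * pgf a b (s - r) (t - r) ^+ 2))%:E)%E.
Proof.
move=> a01 b01 /andP[s0 st].
have mW : measurable_fun setT (weight a b s t) by exact: measurable_weightQ.
have mL := @measurable_leaf_weight R a b (t - s).
rewrite -pgfE// branching//; last by move=> w; exact: weight_bounds.
have me : measurable_fun setT (fun r => (c * expR (- c * r))%:E).
  apply/measurable_EFinP; apply: measurable_funM => //.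
  by apply: measurableT_comp; [exact: measurable_expR|exact: mulrl_measurable].
have msub (F : @tree_space R -> R) : measurable_fun setT F -> (forall w, 0 <= F w <= 1) ->
    measurable_fun setT (fun r => subtree_mean (EFin \o F) r * (c * expR (- c * r))%:E)%E.
  move=> mF F01; apply: emeasurable_funM => //; apply: measurable_subtree_mean.
    exact/measurable_EFinP.
  by move=> w; rewrite lee_fin; have /andP[] := F01 w.
have sub0 (F : @tree_space R -> R) r : measurable_fun setT F -> (forall w, 0 <= F w <= 1) ->
    (0 <= subtree_mean (EFin \o F) r * (c * expR (- c * r))%:E)%E.
  move=> mF F01; have /andP[S0 _] := subtree_mean_bounds r mF F01.
  by rewrite mule_ge0// lee_fin mulr_ge0 ?expR_ge0// ltW.
have W01 w := weight_bounds s t w a01 b01.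
have L01 w := leaf_weight_bounds (t - s) w a01 b01.
have -> : `[0, +oo[%classic = `[0, s] `|` `]s, +oo[ :> set R.
  apply/seteqP; split => r /=; rewrite !in_itv /= ?andbT.
    by move=> r0; have [rs|rs] := leP r s; [left; rewrite r0|right].
  by move=> [/andP[]//|/ltW]; exact: le_trans.
rewrite ge0_integral_setU//=; last 3 first.
- by apply: measurable_funTS; exact: msub.
- by move=> r _; exact: sub0.
- by apply/disj_setPS => r /= []; rewrite !in_itv/= andbT => /andP[_ rs]; rewrite ltNge rs.
rewrite addeC; congr (_ + _)%E.
  rewrite branching// -integral_itv_obnd_cbnd; last first.
    by apply: measurable_funTS; exact: msub.
  rewrite -(@lebesgue_integral_shift _ _ s)//; last 2 first.
  - exact: msub.
  - by move=> r; exact: sub0.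
  rewrite -ge0_integralZl//; last 2 first.
  - apply: measurable_funTS.
    apply: (measurableT_comp (f := fun r => (subtree_mean (EFin \o leaf_weight a b (t - s)) r *
      (c * expR (- c * r))%:E)%E)); first exact: msub.
    exact: measurable_funB.
  - by move=> r _; exact: sub0.
  apply: eq_integral => r; rewrite inE /= in_itv/= andbT => sr.
  rewrite subtree_mean_root ?s0// muleCA -EFinM; congr (_ * _%:E)%E.
  by rewrite mulrCA -expRD; congr (_ * expR _); ring.
apply: eq_integral => r; rewrite inE /= in_itv/= => /andP[r0 rs].
rewrite subtree_mean_split ?rs// -EFinM; congr EFin.
have -> : mu = c * (1 - p) by rewrite /p /c; field; exact: lt0r_neq0.
have -> : lambda = c * p by rewrite /p mulrC divfK// gt_eqF.
by rewrite /p; ring.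
Qed.

Lemma weight1 (b t : R) (w : @tree_space R) : weight 1 b t t w = gpow b (nb_ancestral t t w).
Proof.
rewrite /weight; have := nb_ancestral_count t t w.
move: (nb_ancestral t t w) => N [->|[n ->]] /=; first by rewrite mulr0.
by rewrite powR1 mul1r.
Qed.

(** Almost surely the root alone is alive at time 0. The integral is restricted to r > 0 because the
    root is not alive at its own end point. *)
Let pgf_origin b : 0 <= b <= 1 -> pgf 1 b 0 0 = b.
Proof.
move=> b01; have i01 : 0 <= (1 : R) <= 1 by rewrite ler01 lexx.
have W01 w := weight_bounds 0 0 w i01 b01.
apply: EFin_inj; rewrite -pgfE// branching//.
have mb : measurable_fun setT (fun r : R => b%:E * (c * expR (- c * r))%:E)%E.
  apply: emeasurable_funM => //; apply/measurable_EFinP; apply: measurable_funM => //.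
  by apply: measurableT_comp; [exact: measurable_expR|exact: mulrl_measurable].
transitivity (\int[lebesgue_measure]_(r in `[0%R, +oo[)
    (cst b%:E r * (c * expR (- c * r))%:E))%E; last first.
  rewrite -(integral_exponential_law c_gt0 EE)//.
  transitivity (b%:E * E setT)%E; last by rewrite probability_setT mule1.
  exact: (integral_cst E measurableT).
rewrite -integral_itv_obnd_cbnd; last first.
  apply: measurable_funTS; apply: emeasurable_funM.
    apply: measurable_subtree_mean; first exact/measurable_EFinP.
    by move=> w; rewrite lee_fin; have /andP[] := W01 w.
  apply/measurable_EFinP; apply: measurable_funM => //.
  by apply: measurableT_comp; [exact: measurable_expR|exact: mulrl_measurable].
rewrite -[RHS]integral_itv_obnd_cbnd; last exact: measurable_funTS.
apply: eq_integral => r; rewrite inE /= in_itv/= andbT => r0; congr (_ * _)%E.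
have z x : (\int[Q \x Q]_y (weight 1 b 0 0 (graft (r, x) y.1 y.2))%:E = b%:E)%E.
  transitivity (\int[subtreeP]_(y in setT) b%:E)%E; last first.
    transitivity (b%:E * subtreeP setT)%E; last by rewrite probability_setT mule1.
    exact: (integral_cst subtreeP measurableT).
  apply: (@ge0_ae_eq_integral _ _ _ subtreeP) => //.
  - exact: measurable_on_graft.
  - by move=> y _; rewrite lee_fin; have /andP[] := W01 (graft (r, x) y.1 y.2).
  - by move=> y _; rewrite lee_fin; have /andP[] := b01.
  apply: negligibleS subtree_nonneg_ae => y /= + [y1 y2]; apply => _.
  rewrite weight1 nb_ancestral_graft_root ?lexx//; case: ifPn => [|_].
    rewrite counting_eq0 ancestral_refl => /asboolP N0.
    have : living 0 (graft (r, x) y.1 y.2) [::] by apply/living_graft_nil; rewrite lexx.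
    by rewrite N0.
  by rewrite /= powRr1//; have /andP[] := b01.
rewrite /subtree_mean /= !z -!EFinM -EFinD; congr EFin; ring.
Qed.

(** The root event shifts both observation times by r, so the lag is constant along the integral
    equation and uniqueness applies with s as the only variable. *)
Let flow_eq a b tau : 0 <= a <= 1 -> 0 <= b <= 1 -> 0 <= tau ->
  forall s, 0 <= s -> pgf a b s (s + tau) =
    bd_flow lambda mu ((1 - a) * pgf 1 0 tau tau + a * pgf 1 b tau tau) s.
Proof.
move=> a01 b01 tau0; have i01 : 0 <= (1 : R) <= 1 by rewrite ler01 lexx.
have z01 : 0 <= (0 : R) <= 1 by rewrite ler01 lexx.
have /andP[a0 a1] := a01.
have P0 := pgf_bounds tau tau i01 z01; have Pb := pgf_bounds tau tau i01 b01.
apply: (bd_flow_unique lambda_gt0 mu_ge0 mu_le).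
- have /andP[x0 x1] := P0; have /andP[y0 y1] := Pb.
  rewrite addr_ge0 ?mulr_ge0 ?subr_ge0//=.
  by rewrite -[leRHS](subrK a) lerD// ler_piMr ?subr_ge0.
- exact: measurable_pgf.
- by move=> s; exact: pgf_bounds.
move=> s s0; rewrite (@pgf_integral_equation a b s (s + tau) a01 b01); last first.
  by rewrite s0 lerDl.
apply: (@f_equal2 _ _ _ (fun x y : \bar R => (x + y)%E)); last first.
  apply: eq_integral => r _.
  by rewrite (_ : s + tau - r = s - r + tau)//; ring.
rewrite (_ : s + tau - s = tau); last by ring.
rewrite EFinM; congr (_ * _)%E.
rewrite /leaf_weight; under eq_integral do rewrite -!weight1 EFinD (EFinM (1 - a)) (EFinM a).
have m b' : measurable_fun setT (EFin \o weight 1 b' tau tau) by exact/measurable_EFinP.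
rewrite ge0_integralD//; last 4 first.
- move=> w _; rewrite -EFinM lee_fin mulr_ge0 ?subr_ge0//.
  by have /andP[] := weight_bounds tau tau w i01 z01.
- by apply: measurable_funeM; exact: (m 0).
- move=> w _; rewrite -EFinM lee_fin mulr_ge0//.
  by have /andP[] := weight_bounds tau tau w i01 b01.
- by apply: measurable_funeM; exact: (m b).
rewrite !ge0_integralZl//; last 5 first.
- exact: (m b).
- by move=> w _; rewrite lee_fin; have /andP[] := weight_bounds tau tau w i01 b01.
- exact: (m 0).
- by move=> w _; rewrite lee_fin; have /andP[] := weight_bounds tau tau w i01 z01.
- by rewrite lee_fin subr_ge0.
by rewrite !pgfE.
Qed.

(** Case a = 1 and lag 0 of [flow_eq]; it supplies the initial values at a positive lag in
    [pgf_flow]. *)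
Lemma pgf_population b t : 0 <= b <= 1 -> 0 <= t -> pgf 1 b t t = bd_flow lambda mu b t.
Proof.
move=> b01 t0; have i01 : 0 <= (1 : R) <= 1 by rewrite ler01 lexx.
have := flow_eq i01 b01 (lexx 0) t0; rewrite addr0 => ->.
by rewrite subrr mul0r add0r mul1r pgf_origin.
Qed.

Lemma pgf_flow a b s tau : 0 <= a <= 1 -> 0 <= b <= 1 -> 0 <= s -> 0 <= tau ->
  pgf a b s (s + tau) = bd_flow lambda mu
    ((1 - a) * bd_flow lambda mu 0 tau + a * bd_flow lambda mu b tau) s.
Proof.
move=> a01 b01 s0 tau0; rewrite flow_eq// !pgf_population//.
by rewrite ler01 lexx.
Qed.

End generating_function.

(** * Power series of the rational functions that occur *)

Section generating_series.
Context {R : realType}.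

Lemma linear_fractional_nneseries (c0 K z a : R) : 0 <= c0 -> 0 <= K -> 0 <= z ->
  0 <= a -> z * a < 1 ->
  (\sum_(0 <= m <oo) ((if m is k.+1 then K * z ^+ k else c0) * a ^+ m)%:E)%E =
  (c0 + K * a / (1 - z * a))%:E.
Proof.
move=> c00 K0 z0 a0 za1; have za0 : 0 <= z * a by exact: mulr_ge0.
rewrite nneseries_recl//; last first.
  by move=> [|k] _; rewrite lee_fin ?mulr1// !mulr_ge0 ?exprn_ge0.
rewrite -nneseries_addn; last first.
  by move=> [|k]; rewrite lee_fin !mulr_ge0 ?exprn_ge0.
rewrite expr0 mulr1 EFinD EFinM -geometric_nneseries ?za0// -nneseriesZl; last first.
  by move=> k _; rewrite lee_fin exprn_ge0.
congr (_ + _)%E; apply: eq_eseriesr => k _.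
by rewrite addn1 -EFinM exprMn exprS; congr EFin; ring.
Qed.

Lemma geometric_mean_nneseries (c0 K z : R) : 0 <= K -> 0 <= z < 1 ->
  (\sum_(0 <= m <oo) (m%:R * (if m is k.+1 then K * z ^+ k else c0))%:E)%E =
  (K / (1 - z) ^+ 2)%:E.
Proof.
move=> K0 z01; have /andP[z0 z1] := z01.
rewrite EFinM -derived_geometric_nneseries// -nneseriesZl; last first.
  by move=> k _; rewrite lee_fin mulr_ge0 ?exprn_ge0.
apply: eq_eseriesr => -[|k] _; rewrite -EFinM; congr EFin.
  by rewrite !mul0r mulr0.
by rewrite /=; ring.
Qed.

Lemma size_biased_nneseries (K L z b : R) : 0 <= K -> 0 <= L -> 0 <= z -> 0 <= b ->
  z * b < 1 ->
  (\sum_(0 <= n <oo) ((if n is k.+1 then K * z ^+ k + L * (k%:R * z ^+ k.-1) else 0)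
     * b ^+ n)%:E)%E =
  (K * b / (1 - z * b) + L * b ^+ 2 / (1 - z * b) ^+ 2)%:E.
Proof.
move=> K0 L0 z0 b0 zb1; have zb0 : 0 <= z * b by exact: mulr_ge0.
rewrite EFinD -[K * b / _]add0r -linear_fractional_nneseries//.
rewrite [(L * _ / _)%:E]EFinM -derived_geometric_nneseries ?zb0//.
rewrite -nneseriesZl; last by move=> k _; rewrite lee_fin mulr_ge0 ?exprn_ge0.
pose v n : \bar R := ((L * b ^+ 2)%:E * (n%:R * (z * b) ^+ n.-1)%:E)%E.
have v0 n : (0 <= v n)%E by rewrite mule_ge0// lee_fin mulr_ge0 ?exprn_ge0.
have -> : (\sum_(0 <= n <oo) v n = \sum_(0 <= n <oo) (if n is k.+1 then v k else 0))%E.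
  rewrite [RHS]nneseries_recl ?add0e; [|by case|by []].
  rewrite -[RHS]nneseries_addn; last by case.
  by apply: eq_eseriesr => n _; rewrite addn1.
rewrite -nneseriesD; last 2 first.
- by move=> [|k] _ _; rewrite lee_fin ?mul0r// !mulr_ge0 ?exprn_ge0.
- by move=> [|k] _ _.
apply: eq_eseriesr => -[|k] _; first by rewrite mul0r adde0.
rewrite /v -EFinM -EFinD; congr EFin; case: k => [|k]; first by rewrite !mul0r !mulr0 !addr0.
by rewrite /= exprMn !exprS; ring.
Qed.

End generating_series.

(** * Expansion of the composed flow in a and b *)

Section composed_flow.
Context {R : realType} (lambda mu : R).
Hypotheses (lambda_gt0 : 0 < lambda) (mu_ge0 : 0 <= mu) (mu_le : mu <= lambda).
Let rho := mu / lambda.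
Let beta := bd_beta lambda mu.

Let rho_ge0 : 0 <= rho. Proof. by rewrite divr_ge0// ltW. Qed.

Let rho_le1 : rho <= 1. Proof. by rewrite ler_pdivrMr// mul1r. Qed.

Let zero01 : 0 <= (0 : R) <= 1. Proof. by rewrite lexx ler01. Qed.

Let beta_ge0 t : 0 <= t -> 0 <= beta t. Proof. exact: bd_beta_ge0. Qed.

Let beta_lt1 t : 0 <= t -> beta t < 1. Proof. exact: bd_beta_lt1. Qed.

Let rhob_lt1 t : 0 <= t -> rho * beta t < 1.
Proof.
by move=> t0; rewrite (le_lt_trans _ (beta_lt1 t0))// ler_piMl// beta_ge0.
Qed.

(** Probability of exactly one lineage at time t; also the derivative of [beta] divided by [lambda],
    which makes the integrals over the age explicit. *)
Definition bd_mass (t : R) : R := (1 - rho * beta t) * (1 - beta t).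

Lemma bd_mass_gt0 t : 0 <= t -> 0 < bd_mass t.
Proof. by move=> t0; rewrite mulr_gt0// subr_gt0 ?rhob_lt1 ?beta_lt1. Qed.

Let den_gt0 s t : 0 <= s -> 0 <= t -> 0 < 1 - rho * beta s * beta t.
Proof.
move=> s0 t0; rewrite subr_gt0 (le_lt_trans _ (beta_lt1 t0))// ler_piMl ?beta_ge0//.
by rewrite ltW// rhob_lt1.
Qed.

Let betaD s t : 0 <= s -> 0 <= t -> beta (s + t) =
  (beta s + beta t - (1 + rho) * beta s * beta t) / (1 - rho * beta s * beta t).
Proof.
move=> s0 t0; have d0 := lt0r_neq0 (den_gt0 s0 t0).
by apply: (mulIf d0); rewrite divfK// bd_betaD.
Qed.

Lemma bd_beta_le s t : 0 <= s -> 0 <= t -> beta t <= beta (s + t).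
Proof.
move=> s0 t0; rewrite betaD// ler_pdivlMr ?den_gt0// -subr_ge0.
rewrite (_ : _ - _ = beta s * (1 - beta t) * (1 - rho * beta t)); last by ring.
by rewrite !mulr_ge0 ?beta_ge0// subr_ge0 ltW// ?beta_lt1// rhob_lt1.
Qed.

(* Weight of the generating function b of one surviving lineage of age t. *)
Let Y t b := bd_mass t * b / (1 - beta t * b).

Let geo_den_gt0 t b : 0 <= t -> 0 <= b <= 1 -> 0 < 1 - beta t * b.
Proof. by move=> t0 b01; exact: bd_flow_den_gt0. Qed.

Let Y_ge0 t b : 0 <= t -> 0 <= b <= 1 -> 0 <= Y t b.
Proof.
move=> t0 b01; have /andP[b0 _] := b01.
by rewrite divr_ge0 ?(ltW (geo_den_gt0 t0 b01))// mulr_ge0// ltW// bd_mass_gt0.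
Qed.

Let bd_flow_geometric t b : 0 <= t -> 0 <= b <= 1 ->
  bd_flow lambda mu b t = rho * beta t + Y t b.
Proof.
move=> t0 b01; have d0 := lt0r_neq0 (geo_den_gt0 t0 b01).
by rewrite /bd_flow /Y /bd_mass -/rho -/beta; field.
Qed.

(** With [K] and [c0] below: the flow over time s from [rho * beta t + a * Y t b] is c0 + K a / (1 -
    Z a), a geometric series in a. *)
Let Z s t b := beta s * Y t b / (1 - rho * beta s * beta t).

Let K s t b := bd_mass s * Y t b / (1 - rho * beta s * beta t) ^+ 2.

Let flow_in01 t b : 0 <= t -> 0 <= b <= 1 -> 0 <= rho * beta t + Y t b <= 1.
Proof. by move=> t0 b01; rewrite -bd_flow_geometric// bd_flow_bounds. Qed.

Let Z_ge0 s t b : 0 <= s -> 0 <= t -> 0 <= b <= 1 -> 0 <= Z s t b.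
Proof.
move=> s0 t0 b01.
by rewrite divr_ge0 ?(ltW (den_gt0 s0 t0))// mulr_ge0 ?beta_ge0 ?Y_ge0.
Qed.

Let Z_lt1 s t b : 0 <= s -> 0 <= t -> 0 <= b <= 1 -> Z s t b < 1.
Proof.
move=> s0 t0 b01; rewrite ltr_pdivrMr ?den_gt0// mul1r -subr_gt0.
rewrite (_ : _ - _ = 1 - beta s * (rho * beta t + Y t b)); last by ring.
exact: (bd_flow_den_gt0 lambda_gt0 mu_ge0 mu_le (flow_in01 t0 b01) s0).
Qed.

Let K_ge0 s t b : 0 <= s -> 0 <= t -> 0 <= b <= 1 -> 0 <= K s t b.
Proof.
move=> s0 t0 b01.
by rewrite divr_ge0 ?exprn_ge0 ?(ltW (den_gt0 s0 t0))// mulr_ge0 ?Y_ge0// ltW// bd_mass_gt0.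
Qed.

Let c0 s t := bd_flow lambda mu (rho * beta t) s.

Let c0_ge0 s t : 0 <= s -> 0 <= t -> 0 <= c0 s t.
Proof.
move=> s0 t0; suff /andP[] : 0 <= c0 s t <= 1 by [].
by rewrite bd_flow_bounds// mulr_ge0 ?beta_ge0// ltW// rhob_lt1.
Qed.

(* Coefficient of a ^ m in bd_flow_composed_nneseries. *)
Definition bd_survivor_coef (s t b : R) (m : nat) : R :=
  if m is k.+1 then K s t b * Z s t b ^+ k else c0 s t.

Lemma bd_survivor_coef_ge0 s t b m : 0 <= s -> 0 <= t -> 0 <= b <= 1 ->
  0 <= bd_survivor_coef s t b m.
Proof.
move=> s0 t0 b01; case: m => [|k] /=; first exact: c0_ge0.
by apply: mulr_ge0; [exact: K_ge0|apply: exprn_ge0; exact: Z_ge0].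
Qed.

Lemma bd_flow_composed_nneseries s t a b : 0 <= s -> 0 <= t -> 0 <= a <= 1 -> 0 <= b <= 1 ->
  (\sum_(0 <= m <oo) (bd_survivor_coef s t b m * a ^+ m)%:E)%E =
  (bd_flow lambda mu ((1 - a) * bd_flow lambda mu 0 t + a * bd_flow lambda mu b t) s)%:E.
Proof.
move=> s0 t0 a01 b01; have /andP[a0 a1] := a01.
have z0 := Z_ge0 s0 t0 b01; have z1 := Z_lt1 s0 t0 b01.
have za1 : Z s t b * a < 1 by rewrite (le_lt_trans _ z1)// ler_piMr.
rewrite linear_fractional_nneseries ?c0_ge0 ?K_ge0//; congr EFin.
rewrite (bd_flow_geometric t0 zero01) (bd_flow_geometric t0 b01).
have -> : Y t 0 = 0 by rewrite /Y mulr0 mul0r.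
have D0 := lt0r_neq0 (den_gt0 s0 t0).
have : 1 - beta s * (rho * beta t + a * Y t b) != 0.
  rewrite lt0r_neq0//.
  rewrite (_ : _ - _ = (1 - rho * beta s * beta t) * (1 - Z s t b * a)).
    by rewrite mulr_gt0 ?den_gt0// subr_gt0.
  by rewrite /Z; field.
have : 1 - Z s t b * a != 0 by rewrite subr_eq0 gt_eqF.
rewrite /c0 /bd_flow -/rho -/beta /K /Z /bd_mass.
move: D0; move: (Y t b) (beta s) (beta t) => y bs bt D0 d1 d2.
have d3 : 1 - bs * (rho * bt) != 0 by rewrite (_ : _ - _ = 1 - rho * bs * bt)//; ring.
rewrite (_ : (1 - a) * _ + _ = rho * bt + a * y); last by ring.
by field; rewrite d2 D0.
Qed.

Lemma bd_flow_nneseries t b : 0 <= t -> 0 <= b <= 1 ->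
  (\sum_(0 <= n <oo) ((if n is k.+1 then bd_mass t * beta t ^+ k else rho * beta t)
     * b ^+ n)%:E)%E = (bd_flow lambda mu b t)%:E.
Proof.
move=> t0 b01; have /andP[b0 b1] := b01; have d0 := geo_den_gt0 t0 b01.
rewrite linear_fractional_nneseries ?beta_ge0 ?(ltW (bd_mass_gt0 t0))//.
- by rewrite bd_flow_geometric.
- by rewrite mulr_ge0 ?beta_ge0.
- by rewrite -subr_gt0.
Qed.

(** Closed form of the sum of m P[M = m, n alive at s + t], with M counted at time s ([joint_mean]).
    For s + t > 0, dividing by the probability of k + 1 living lineages leaves 1 + k (1 - beta t /
    beta (s + t)). At k = 0 the truncated exponent is harmless, the factor k being 0. *)
Definition bd_size_biased (s t : R) (n : nat) : R :=
  if n is k.+1 then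
    bd_mass (s + t) * beta (s + t) ^+ k +
    bd_mass (s + t) * (beta (s + t) - beta t) * (k%:R * beta (s + t) ^+ k.-1)
  else 0.

Lemma bd_size_biased_ge0 s t n : 0 <= s -> 0 <= t -> 0 <= bd_size_biased s t n.
Proof.
move=> s0 t0; have st0 := addr_ge0 s0 t0; have b0 := beta_ge0 st0.
have m0 := ltW (bd_mass_gt0 st0).
have d0 : 0 <= beta (s + t) - beta t by rewrite subr_ge0 bd_beta_le.
case: n => //= k; apply: addr_ge0; first by apply: mulr_ge0 => //; exact: exprn_ge0.
apply: mulr_ge0; first exact: mulr_ge0.
by apply: mulr_ge0 => //; exact: exprn_ge0.
Qed.

(** Both series have rational sums, K / (1 - Z) ^ 2 on the right; once [beta (s + t)] is expanded by
    [betaD] they are the same rational function of b. *)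
Lemma bd_size_biased_nneseries s t b : 0 <= s -> 0 <= t -> 0 <= b <= 1 ->
  (\sum_(0 <= n <oo) (bd_size_biased s t n * b ^+ n)%:E)%E =
  (\sum_(0 <= m <oo) (m%:R * bd_survivor_coef s t b m)%:E)%E.
Proof.
move=> s0 t0 b01; have /andP[b0 b1] := b01; have st0 := addr_ge0 s0 t0.
have dst := geo_den_gt0 st0 b01.
rewrite size_biased_nneseries ?beta_ge0 ?(ltW (bd_mass_gt0 st0))//; last 2 first.
- by rewrite mulr_ge0 ?subr_ge0 ?bd_beta_le// ltW// bd_mass_gt0.
- by rewrite -subr_gt0.
rewrite geometric_mean_nneseries ?K_ge0 ?Z_ge0 ?Z_lt1//; congr EFin.
have z1 := Z_lt1 s0 t0 b01; have /lt0r_neq0 dt := geo_den_gt0 t0 b01.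
have /lt0r_neq0 D0 := den_gt0 s0 t0.
move: dst z1; rewrite /K /Z /Y /bd_mass !betaD//.
move: D0 dt; move: (beta s) (beta t) => bs bt D0 dt dst z1.
have e1 : 1 - rho * bs * bt - (bs + bt - (1 + rho) * bs * bt) * b != 0.
  rewrite (_ : _ - _ = (1 - rho * bs * bt) *
    (1 - (bs + bt - (1 + rho) * bs * bt) / (1 - rho * bs * bt) * b)); last by field.
  by rewrite mulf_neq0// lt0r_neq0.
field; rewrite D0 dt /=.
by rewrite (_ : _ - _ = 1 - rho * bs * bt - (bs + bt - (1 + rho) * bs * bt) * b)//; ring.
Qed.

Lemma bd_size_biased_lty s t b : 0 <= s -> 0 <= t -> 0 <= b <= 1 ->
  (\sum_(0 <= n <oo) (bd_size_biased s t n * b ^+ n)%:E < +oo)%E.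
Proof.
move=> s0 t0 b01.
by rewrite bd_size_biased_nneseries// geometric_mean_nneseries ?K_ge0 ?Z_ge0 ?Z_lt1// ltry.
Qed.

End composed_flow.

(** * From generating functions to probabilities *)

Section coefficient_extraction.
Context {R : realType} (Q : probability (@tree_space R) R) (lambda mu : R).
Hypotheses (lambda_gt0 : 0 < lambda) (mu_ge0 : 0 <= mu) (mu_le : mu <= lambda).
Hypothesis pgf_populationE : forall b t, 0 <= b <= 1 -> 0 <= t ->
  pgf Q 1 b t t = bd_flow lambda mu b t.
Hypothesis pgfD : forall a b s t, 0 <= a <= 1 -> 0 <= b <= 1 -> 0 <= s -> 0 <= t ->
  pgf Q a b s (s + t) = bd_flow lambda mu
    ((1 - a) * bd_flow lambda mu 0 t + a * bd_flow lambda mu b t) s.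

Definition nb_eq (s t : R) (m : nat) : set (@tree_space R) :=
  [set w | nb_ancestral s t w = m%:R%:E].

Lemma measurable_nb_eq s t m : measurable (nb_eq s t m).
Proof.
have mN : measurable_fun setT (fun w : @tree_space R => nb_ancestral s t w).
  exact: measurable_nb_ancestral.
rewrite (_ : nb_eq s t m = setT `&` (fun w => nb_ancestral s t w) @^-1` [set m%:R%:E]).
  exact: (mN measurableT).
by rewrite setTI.
Qed.

(** At most one term is nonzero, and none if the count is infinite, in accordance with the value of
    [gpow] there. *)
Lemma gpow_nneseries (a : R) (x : \bar R) : 0 <= a -> is_count x ->
  ((gpow a x)%:E = \sum_(0 <= m <oo) ((x == m%:R%:E)%:R * a ^+ m)%:E)%E.
Proof.
move=> a0 [->|[n ->]].
  by rewrite eseries0// => m _ _; rewrite mul0r.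
rewrite (@nneseriesD1 _ _ n)//; last by move=> k _; rewrite lee_fin mulr_ge0 ?exprn_ge0.
rewrite eqxx mul1r gpow_nat// eseries0 ?adde0// => m _ /= mn.
by rewrite eqe eqr_nat eq_sym (negbTE mn) mul0r.
Qed.

Let indic_nb_eq s t m (w : @tree_space R) :
  ((nb_ancestral s t w == m%:R%:E)%:R : R) = \1_(nb_eq s t m) w.
Proof.
by rewrite indicE; case: eqP => h; [rewrite mem_set|rewrite memNset].
Qed.

Definition joint_law (s t : R) (m n : nat) : R :=
  fine (Q (nb_eq s t m `&` nb_eq t t n)).

Lemma joint_lawE s t m n : (joint_law s t m n)%:E = Q (nb_eq s t m `&` nb_eq t t n).
Proof.
by rewrite fineK// fin_num_measure//; apply: measurableI; exact: measurable_nb_eq.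
Qed.

Let joint_law_ge0 s t m n : 0 <= joint_law s t m n.
Proof. by rewrite -lee_fin joint_lawE. Qed.

(** Coefficient of a ^ m in the generating function, b being kept as a parameter. *)
Let partial_pgf (b s t : R) (m : nat) : \bar R :=
  (\int[Q]_w ((nb_ancestral s t w == m%:R%:E)%:R * gpow b (nb_ancestral t t w))%:E)%E.

Let measurable_nbQ s t : measurable_fun setT (fun w : @tree_space R => nb_ancestral s t w).
Proof. exact: measurable_nb_ancestral. Qed.

Let measurable_gpowQ b t :
  measurable_fun setT (fun w : @tree_space R => gpow b (nb_ancestral t t w)).
Proof. exact: (measurableT_comp (measurable_gpow b) (measurable_nbQ t t)). Qed.

Let measurable_indic_nb s t m : measurable_fun setT
  (fun w : @tree_space R => ((nb_ancestral s t w == m%:R%:E)%:R : R)).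
Proof.
rewrite (_ : (fun w : @tree_space R => _) = \1_(nb_eq s t m)).
  by apply: measurable_indic; exact: measurable_nb_eq.
by apply/funext => w; exact: indic_nb_eq.
Qed.

Let gpow_ge0 (b s t : R) (w : @tree_space R) : 0 <= b <= 1 -> 0 <= gpow b (nb_ancestral s t w).
Proof. by move=> b01; have /andP[] := gpow_bounds b01 (nb_ancestral_count s t w). Qed.

Let partial_pgf_nneseries b s t m : 0 <= b <= 1 ->
  partial_pgf b s t m = (\sum_(0 <= n <oo) (joint_law s t m n * b ^+ n)%:E)%E.
Proof.
move=> b01; have /andP[b0 _] := b01.
transitivity (\int[Q]_w \sum_(0 <= n <oo)
   ((b ^+ n)%:E * (\1_(nb_eq s t m `&` nb_eq t t n) w)%:E))%E.
  apply: eq_integral => w _.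
  rewrite EFinM gpow_nneseries//; last exact: nb_ancestral_count.
  rewrite -nneseriesZl; last by move=> n _; rewrite lee_fin mulr_ge0 ?exprn_ge0.
  apply: eq_eseriesr => n _.
  by rewrite !indic_nb_eq -!EFinM indicI/=; congr EFin; ring.
rewrite integral_nneseries//; last 2 first.
- move=> n; apply: measurable_funeM; apply/measurable_EFinP.
  by apply: measurable_indic; apply: measurableI; exact: measurable_nb_eq.
- by move=> n w _; rewrite -EFinM lee_fin mulr_ge0 ?exprn_ge0.
apply: eq_eseriesr => n _.
have mI : measurable (nb_eq s t m `&` nb_eq t t n).
  by apply: measurableI; exact: measurable_nb_eq.
rewrite ge0_integralZl//; last 2 first.
- by apply/measurable_EFinP; exact: measurable_indic.
- by rewrite lee_fin exprn_ge0.
transitivity ((b ^+ n)%:E * Q (nb_eq s t m `&` nb_eq t t n))%E.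
  by congr (_ * _)%E; rewrite integral_indic// setIT.
by rewrite -joint_lawE -EFinM mulrC.
Qed.

Let pgf_nneseries a b s t : 0 <= a <= 1 -> 0 <= b <= 1 ->
  ((pgf Q a b s t)%:E = \sum_(0 <= m <oo) ((a ^+ m)%:E * partial_pgf b s t m))%E.
Proof.
move=> a01 b01; have /andP[a0 _] := a01; rewrite -pgfE//.
transitivity (\int[Q]_w \sum_(0 <= m <oo) ((a ^+ m)%:E *
   ((nb_ancestral s t w == m%:R%:E)%:R * gpow b (nb_ancestral t t w))%:E))%E.
  apply: eq_integral => w _.
  rewrite /weight mulrC EFinM (gpow_nneseries a0 (nb_ancestral_count s t w)).
  rewrite -nneseriesZl; last by move=> n _; rewrite lee_fin mulr_ge0 ?exprn_ge0.
  by apply: eq_eseriesr => n _; rewrite -!EFinM; congr EFin; ring.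
rewrite integral_nneseries//; last 2 first.
- move=> n; apply: measurable_funeM; apply/measurable_EFinP.
  exact: measurable_funM.
- move=> n w _; rewrite -EFinM lee_fin mulr_ge0 ?exprn_ge0//.
  by rewrite mulr_ge0// gpow_ge0.
apply: eq_eseriesr => n _.
rewrite ge0_integralZl//.
- by apply/measurable_EFinP; exact: measurable_funM.
- by move=> w _; rewrite lee_fin mulr_ge0// gpow_ge0.
- by rewrite lee_fin exprn_ge0.
Qed.

Let partial_pgf_ge0 b s t m : 0 <= b <= 1 -> (0 <= partial_pgf b s t m)%E.
Proof.
by move=> b01; apply: integral_ge0 => w _; rewrite lee_fin mulr_ge0// gpow_ge0.
Qed.

Let partial_pgf_fin b s t m : 0 <= b <= 1 -> partial_pgf b s t m \is a fin_num.
Proof.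
move=> b01; have i01 : 0 <= (1 : R) <= 1 by rewrite ler01 lexx.
rewrite ge0_fin_numE ?partial_pgf_ge0//.
apply: (@le_lt_trans _ _ (pgf Q 1 b s t)%:E); last exact: ltry.
rewrite pgf_nneseries// (@nneseriesD1 _ _ m)//; last first.
  by move=> k _; rewrite mule_ge0 ?partial_pgf_ge0// lee_fin exprn_ge0.
rewrite expr1n mul1e leeDl// nneseries_ge0// => k _ _.
by rewrite mule_ge0 ?partial_pgf_ge0// lee_fin exprn_ge0.
Qed.

Let partial_pgfE b s t m : 0 <= b <= 1 -> 0 <= s -> 0 <= t ->
  partial_pgf b s (s + t) m = (bd_survivor_coef lambda mu s t b m)%:E.
Proof.
move=> b01 s0 t0; have i01 : 0 <= (1 : R) <= 1 by rewrite ler01 lexx.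
rewrite -(fineK (partial_pgf_fin s (s + t) m b01)); congr EFin.
apply: (@nneseries_coef_inj _ (fun m => fine (partial_pgf b s (s + t) m))
  (bd_survivor_coef lambda mu s t b) 1).
- exact: ltr01.
- by move=> k; rewrite fine_ge0// partial_pgf_ge0.
- by move=> k; exact: bd_survivor_coef_ge0.
- move=> a /andP[/ltW a0 a1]; have a01 : 0 <= a <= 1 by rewrite a0.
  rewrite bd_flow_composed_nneseries// -pgfD// pgf_nneseries//.
  apply: eq_eseriesr => k _.
  by rewrite EFinM fineK ?partial_pgf_fin// muleC.
- by rewrite bd_flow_composed_nneseries// ltry.
Qed.

(** The coefficients in a, weighted by m, are summed; exchanging the two nonnegative sums gives a
    power series in b, whose coefficients are then compared. *)
Lemma joint_mean s t n : 0 <= s -> 0 <= t ->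
  (\sum_(0 <= m <oo) (m%:R * joint_law s (s + t) m n)%:E =
   (bd_size_biased lambda mu s t n)%:E)%E.
Proof.
move=> s0 t0; have i01 : 0 <= (1 : R) <= 1 by rewrite ler01 lexx.
pose M n := (\sum_(0 <= m <oo) (m%:R * joint_law s (s + t) m n)%:E)%E.
have M0 k : (0 <= M k)%E.
  by apply: nneseries_ge0 => m _ _; rewrite lee_fin mulr_ge0.
have series b : 0 <= b <= 1 -> (\sum_(0 <= n <oo) ((b ^+ n)%:E * M n) =
    \sum_(0 <= n <oo) (bd_size_biased lambda mu s t n * b ^+ n)%:E)%E.
  move=> b01; have /andP[b0 _] := b01.
  rewrite bd_size_biased_nneseries//.
  transitivity (\sum_(0 <= n <oo) \sum_(0 <= m <oo)
      (m%:R * (joint_law s (s + t) m n * b ^+ n))%:E)%E.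
    apply: eq_eseriesr => k _; rewrite -nneseriesZl; last first.
      by move=> m _; rewrite lee_fin mulr_ge0.
    by apply: eq_eseriesr => m _; rewrite -EFinM; congr EFin; ring.
  rewrite nneseries_interchange; last first.
    by move=> k m; rewrite lee_fin !mulr_ge0 ?exprn_ge0.
  apply: eq_eseriesr => m _.
  rewrite EFinM -partial_pgfE// partial_pgf_nneseries// -nneseriesZl; last first.
    by move=> k _; rewrite lee_fin mulr_ge0 ?exprn_ge0.
  by apply: eq_eseriesr => k _; rewrite -EFinM.
have fin1 := bd_size_biased_lty lambda_gt0 mu_ge0 mu_le s0 t0 i01.
(* Each [M k] is one term of the series at b = 1, whose sum is finite. *)
have Mfin k : M k \is a fin_num.
  rewrite ge0_fin_numE// (le_lt_trans _ fin1)// -series//.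
  rewrite (@nneseriesD1 _ _ k)//; last by move=> m _; rewrite mule_ge0// lee_fin exprn_ge0.
  rewrite expr1n mul1e leeDl// nneseries_ge0// => m _ _.
  by rewrite mule_ge0// lee_fin exprn_ge0.
rewrite -/(M n) -(fineK (Mfin n)); congr EFin.
apply: (@nneseries_coef_inj _ (fun n => fine (M n)) (bd_size_biased lambda mu s t) 1) => //.
- by move=> k; rewrite fine_ge0.
- by move=> k; exact: bd_size_biased_ge0.
- move=> b /andP[/ltW b0 b1]; rewrite -series ?b0//.
  by apply: eq_eseriesr => k _; rewrite EFinM fineK// muleC.
Qed.

(** With both counts taken at time t the joint law is diagonal, so at a = 1 the double series
    reduces to one in b. *)
Lemma population_law t n : 0 <= t ->
  Q (nb_eq t t n.+1) = (bd_mass lambda mu t * bd_beta lambda mu t ^+ n)%:E.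
Proof.
move=> t0; have i01 : 0 <= (1 : R) <= 1 by rewrite ler01 lexx.
have QE k : Q (nb_eq t t k) = (joint_law t t k k)%:E by rewrite joint_lawE setIid.
rewrite QE; congr EFin.
have series b : 0 <= b <= 1 -> ((bd_flow lambda mu b t)%:E =
    \sum_(0 <= k <oo) (joint_law t t k k * b ^+ k)%:E)%E.
  move=> b01; rewrite -pgf_populationE// pgf_nneseries//.
  apply: eq_eseriesr => k _; rewrite expr1n mul1e partial_pgf_nneseries//.
  rewrite (@nneseriesD1 _ _ k)//; last first.
    by move=> j _; have /andP[b0 _] := b01; rewrite lee_fin mulr_ge0 ?exprn_ge0.
  rewrite eseries0 ?adde0// => j _ /= jk.
  have -> : joint_law t t k j = 0; last by rewrite mul0r.
  apply: EFin_inj; rewrite joint_lawE (_ : _ `&` _ = set0) ?measure0//.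
  apply/seteqP; split => // w [Nk Nj]; suff : (k%:R%:E == j%:R%:E :> \bar R).
    by rewrite eqe eqr_nat eq_sym (negbTE jk).
  by rewrite -Nk -Nj.
apply: (@nneseries_coef_inj _ (fun k => joint_law t t k k) (fun k => if k is k'.+1
   then bd_mass lambda mu t * bd_beta lambda mu t ^+ k'
   else mu / lambda * bd_beta lambda mu t) 1 _ _ _ _ _ n.+1) => //.
- have b0 := bd_beta_ge0 lambda_gt0 mu_ge0 mu_le t0.
  move=> [|k]; first by rewrite mulr_ge0// divr_ge0// ltW.
  by apply: mulr_ge0; [exact/ltW/bd_mass_gt0|exact: exprn_ge0].
- by move=> b /andP[/ltW b0 b1]; rewrite -series ?b0// bd_flow_nneseries ?b0.
- by rewrite bd_flow_nneseries// ltry.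
Qed.

End coefficient_extraction.

(** * Integrals over the age of the tree *)

Section flow_integrals.
Context {R : realType} (lambda mu : R).
Hypotheses (lambda_gt0 : 0 < lambda) (mu_ge0 : 0 <= mu) (mu_le : mu <= lambda).
Let rho := mu / lambda.
Let beta := bd_beta lambda mu.
Let mass := bd_mass lambda mu.

Lemma continuous_bd_beta t : 0 <= t -> {for t, continuous beta}.
Proof.
move=> t0.
exact: (is_derive_continuous (is_derive_bd_beta lambda_gt0 mu_ge0 mu_le t0)).
Qed.

Lemma continuous_bd_mass t : 0 <= t -> {for t, continuous mass}.
Proof.
move=> t0; have Db := is_derive_bd_beta lambda_gt0 mu_ge0 mu_le t0.
have -> : mass = (fun t => 1 + (- rho) * beta t) * (fun t => 1 + (-1) * beta t).
  by apply/funext => x; rewrite /mass /bd_mass -/rho -/beta fctE; ring.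
exact: (is_derive_continuous
  (is_deriveM (is_derive_affine 1 (- rho) Db) (is_derive_affine 1 (-1) Db))).
Qed.

Lemma continuous_bd_betaX k t : 0 <= t -> {for t, continuous (fun t => beta t ^+ k)}.
Proof.
move=> t0; have cb := continuous_bd_beta t0.
elim: k => [|k IH]; first exact: cst_continuous.
rewrite (_ : (fun t => _) = (fun t => beta t * beta t ^+ k)).
  exact: (@continuousM _ _ beta).
by apply/funext => x; rewrite exprS.
Qed.

Lemma bd_beta_cvg1 : beta t @[t --> +oo%R] --> (1 : R).
Proof.
have [ml|ml] := boolP (mu == lambda).
  rewrite (_ : beta = fun t => lambda * t / (1 + lambda * t)); last first.
    by apply/funext => t; rewrite /beta /bd_beta ml.
  have Hy : 1 + lambda * t @[t --> +oo%R] --> +oo%R.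
    apply/cvgryPge => A; near=> t.
    have : A / lambda <= t by near: t; apply: nbhs_pinfty_ge; exact: num_real.
    by rewrite ler_pdivrMr// mulrC => At; rewrite (le_trans At)// lerDr.
  have V0 : (1 + lambda * t)^-1 @[t --> +oo%R] --> (0 : R).
    by apply/gtr0_cvgV0 => //; exact: (cvgry_gt Hy).
  have H : 1 - (1 + lambda * t)^-1 @[t --> +oo%R] --> (1 - 0 : R).
    by apply: cvgB => //; exact: cvg_cst.
  rewrite subr0 in H; apply: cvg_trans H; apply: near_eq_cvg; near=> t.
  have t0 : 0 < 1 + lambda * t by near: t; exact: (cvgry_gt Hy).
  by field; rewrite lt0r_neq0.
rewrite (_ : beta = fun t => (1 - expR (- (lambda - mu) * t)) /
    (1 - rho * expR (- (lambda - mu) * t))); last first.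
  by apply/funext => t; rewrite /beta /bd_beta (negbTE ml).
have ml0 : 0 < lambda - mu by rewrite subr_gt0 lt_neqAle ml.
have e0 : expR (- (lambda - mu) * t) @[t --> +oo%R] --> (0 : R).
  rewrite (_ : (fun t => expR (- (lambda - mu) * t)) =
    (fun z => expR (- z)) \o (fun z => (lambda - mu) * z)); last first.
    by apply/funext => x /=; rewrite mulNr.
  apply: (@cvg_comp _ _ _ _ _ _ (pinfty_nbhs R)); last exact: cvgr_expR.
  exact: gt0_cvgMry.
have H1 : 1 - expR (- (lambda - mu) * t) @[t --> +oo%R] --> (1 - 0 : R).
  by apply: cvgB; [exact: cvg_cst|exact: e0].
have H2 : 1 - rho * expR (- (lambda - mu) * t) @[t --> +oo%R] --> (1 - rho * 0 : R).
  by apply: cvgB; [exact: cvg_cst|exact: cvgMl_tmp].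
rewrite subr0 in H1; rewrite mulr0 subr0 in H2.
have H3 := cvgM H1 (cvgV (oner_neq0 _) H2).
by rewrite invr1 mulr1 in H3; exact: H3.
Unshelve. all: by end_near. Qed.

(** The integrand has the primitive beta ^ (n + 1) / ((n + 1) lambda), and [beta] runs from 0 to
    1. *)
Lemma bd_mass_integral n :
  (\int[lebesgue_measure]_(t in `[0%R, +oo[) (mass t * beta t ^+ n)%:E =
   ((n.+1%:R * lambda)^-1)%:E)%E.
Proof.
pose F t := (n.+1%:R * lambda)^-1 * beta t ^+ n.+1.
have n0 : n.+1%:R * lambda != 0 by rewrite mulf_neq0// gt_eqF.
have DF (t : R) : 0 <= t -> is_derive t 1 F (mass t * beta t ^+ n).
  move=> t0; have Db := is_derive_bd_beta lambda_gt0 mu_ge0 mu_le t0.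
  have DX : is_derive t 1 (fun u => beta u ^+ n.+1) (n.+1%:R * beta t ^+ n *
      (lambda * (1 - rho * beta t) * (1 - beta t))).
    by have := is_deriveX n.+1 Db; rewrite exprfctE.
  have H := is_derive_affine 0 (n.+1%:R * lambda)^-1 DX.
  rewrite (_ : F = fun u => 0 + (n.+1%:R * lambda)^-1 * beta u ^+ n.+1); last first.
    by apply/funext => u; rewrite add0r.
  apply: (is_derive_eq H); rewrite /mass /bd_mass -/beta -/rho.
  by field; rewrite (lt0r_neq0 lambda_gt0) ?nat1r ?natr1 pnatr_eq0.
have b0 : beta 0 = 0 by exact: bd_beta0.
rewrite (@ge0_continuous_FTC2y _ _ F 0 (n.+1%:R * lambda)^-1).
- by rewrite /F b0 expr0n /= mulr0 sube0.
- move=> x x0; have m0 := bd_mass_gt0 lambda_gt0 mu_ge0 mu_le x0.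
  by rewrite mulr_ge0 ?(ltW m0)// exprn_ge0// bd_beta_ge0.
- apply: continuous_in_subspaceT => x; rewrite inE /= in_itv /= andbT => x0.
  exact: (@continuousM _ _ mass (fun t => beta t ^+ n) x
    (continuous_bd_mass x0) (@continuous_bd_betaX n x x0)).
- have H : (n.+1%:R * lambda)^-1 * beta t ^+ n.+1 @[t --> +oo%R] -->
      ((n.+1%:R * lambda)^-1 * 1 ^+ n.+1 : R).
    by apply: cvgMl_tmp; exact: (continuous_cvg _ (@exprn_continuous _ n.+1 1) bd_beta_cvg1).
  by rewrite expr1n mulr1 in H.
- by move=> x /ltW/DF ?; exact: ex_derive.
- by apply/cvg_at_right_filter; exact: (is_derive_continuous (DF _ (lexx 0))).
- move=> x; rewrite in_itv/= andbT => /ltW/DF ?; by rewrite derive1E derive_val.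
Qed.

(** Part of the integrand due to lineages beyond the first, with k = n - 2. The factor [lambda]
    makes its integral over t independent of the unit of time. *)
Definition bd_gap (sigma : R) (k : nat) (t : R) : R :=
  lambda * (mass t * (beta t - beta ((1 - sigma) * t)) * beta t ^+ k).

Lemma bd_gap_ge0 sigma k t : 0 <= sigma <= 1 -> 0 <= t -> 0 <= bd_gap sigma k t.
Proof.
move=> /andP[s0 s1] t0; have m0 := bd_mass_gt0 lambda_gt0 mu_ge0 mu_le t0.
have st0 : 0 <= (1 - sigma) * t by rewrite mulr_ge0// subr_ge0.
have := @bd_beta_le _ _ _ lambda_gt0 mu_ge0 mu_le _ _ (mulr_ge0 s0 t0) st0.
rewrite (_ : sigma * t + _ = t); last by ring.
rewrite -subr_ge0 => d0; apply: mulr_ge0; first exact: ltW.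
apply: mulr_ge0; last by rewrite exprn_ge0// bd_beta_ge0.
by apply: mulr_ge0 => //; exact: ltW.
Qed.

Lemma continuous_bd_gap sigma k t : 0 <= sigma <= 1 -> 0 <= t ->
  {for t, continuous (bd_gap sigma k)}.
Proof.
move=> /andP[s0 s1] t0; have st0 : 0 <= (1 - sigma) * t by rewrite mulr_ge0// subr_ge0.
have Db := is_derive_bd_beta lambda_gt0 mu_ge0 mu_le t0.
have Ds : is_derive t 1 (fun t => beta ((1 - sigma) * t))
    (lambda * (1 - mu / lambda * beta ((1 - sigma) * t)) *
     (1 - beta ((1 - sigma) * t)) * (1 - sigma)).
  have Dl := is_derive_affine 0 (1 - sigma) (is_derive_id t 1).
  rewrite mulr1 in Dl.
  have -> : (fun t => beta ((1 - sigma) * t)) = beta \o (fun t => 0 + (1 - sigma) * t).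
    by apply/funext => u /=; rewrite add0r.
  have D2 : is_derive (0 + (1 - sigma) * t) 1 beta
      (lambda * (1 - mu / lambda * beta ((1 - sigma) * t)) * (1 - beta ((1 - sigma) * t))).
    by rewrite add0r; exact: is_derive_bd_beta.
  exact: (@is_derive1_comp _ beta (fun t => 0 + (1 - sigma) * t) t _ _ D2 Dl).
have cd : {for t, continuous (fun t => beta t - beta ((1 - sigma) * t))}.
  exact: (is_derive_continuous (is_deriveB Db Ds)).
apply: (@continuousM _ _ (cst lambda)); first exact: cst_continuous.
apply: (@continuousM _ _ (fun t => mass t * (beta t - beta ((1 - sigma) * t)))).
  exact: (@continuousM _ _ mass _ t (continuous_bd_mass t0) cd).
exact: (@continuous_bd_betaX k t t0).
Qed.

Lemma measurable_continuous_ge0 (f : R -> R) :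
  (forall t, 0 <= t -> {for t, continuous f}) -> measurable_fun (`[0, +oo[%classic : set R) f.
Proof.
move=> cf; apply: subspace_continuous_measurable_fun => //.
by apply: continuous_in_subspaceT => x; rewrite inE /= in_itv/= andbT => /cf.
Qed.

End flow_integrals.

(** * Transfer of the given process to the space of trees *)

Section canonical_tree.
Context d (T : measurableType d) (R : realType) (P : probability T R).
Variables (life : seq bool -> {RV P >-> R}) (split : seq bool -> {RV P >-> bool}).
Variables (lambda mu : R).
Hypotheses (lambda_gt0 : 0 < lambda) (mu_ge0 : 0 <= mu) (mu_le : mu <= lambda).
Hypothesis tree : birth_death_tree life split lambda mu.

Definition marks (w : T) : @tree_space R := fun u => (life u w, split u w).

Lemma measurable_marks : measurable_fun setT marks.
Proof.
apply: measurable_fun_tree => u; apply: measurable_fun_pair.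
  exact: measurable_funP.
exact: measurable_funP.
Qed.

Definition tree_law : probability (@tree_space R) R :=
  distribution P (HB.pack marks (isMeasurableFun.Build _ _ _ _ _ measurable_marks)
    : {mfun T >-> @tree_space R}).

(** A cylinder of depth [k] constrains only the finite family [words k], to which the independence
    assumption applies. *)
Lemma tree_law_iid_marks :
  iid_marks tree_law (distribution P (life [::])) (distribution P (split [::])).
Proof.
move=> A C k mA AC.
have mC u : measurable (C u) by [].
transitivity (P (\bigcap_(u in [set` words k]) (life u @^-1` A u `&` split u @^-1` C u))).
  congr (P _); apply/seteqP; split => w /=; first by move=> H u _; exact: (H u).
  move=> H u; have [uk|uk] := ltnP (size u) k; first by apply: H; rewrite /= mem_words.
  by have [-> ->] := AC u uk.
rewrite (life_split_independent tree (uniq_words k) mA mC).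
apply: eq_bigr => u _; congr (_ * _)%E.
  transitivity (exponential_prob (lambda + mu) (A u)).
    exact: (life_exponential tree u (mA u)).
  exact/esym/(life_exponential tree [::] (mA u)).
transitivity (bernoulli_prob (lambda / (lambda + mu)) (C u)).
  exact: (split_bernoulli tree u (mC u)).
exact/esym/(split_bernoulli tree [::] (mC u)).
Qed.

Let origin_exponential (A : set R) : measurable A ->
  distribution P (life [::]) A = exponential_prob (lambda + mu) A.
Proof. exact: (life_exponential tree). Qed.

Let origin_bernoulli (S : set bool) :
  distribution P (split [::]) S = bernoulli_prob (lambda / (lambda + mu)) S.
Proof. exact: (split_bernoulli tree). Qed.

Lemma tree_law_mean s t n : 0 <= s -> 0 <= t ->
  (\sum_(0 <= m <oo) (m%:R * joint_law tree_law s (s + t) m n)%:E =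
   (bd_size_biased lambda mu s t n)%:E)%E.
Proof.
apply: joint_mean => // a b s' t' a01 b01 s0 t0.
exact: (pgf_flow lambda_gt0 mu_ge0 mu_le tree_law_iid_marks
  origin_exponential origin_bernoulli).
Qed.

Lemma tree_law_population t n : 0 <= t ->
  tree_law (nb_eq t t n.+1) = (bd_mass lambda mu t * bd_beta lambda mu t ^+ n)%:E.
Proof.
apply: population_law => // b t' b01 t0.
exact: (pgf_population lambda_gt0 mu_ge0 mu_le tree_law_iid_marks
  origin_exponential origin_bernoulli).
Qed.

Lemma nb_lineages_eqE sigma t m :
  nb_lineages_eq life split sigma t m = marks @^-1` nb_eq (sigma * t) t m.
Proof. by []. Qed.

Lemma prob_nb_lineages_eq t n :
  P (nb_lineages_eq life split 1 t n) = tree_law (nb_eq t t n).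
Proof. by rewrite nb_lineages_eqE mul1r. Qed.

Lemma prob_nb_lineages_eqI sigma t m n :
  P (nb_lineages_eq life split sigma t m `&` nb_lineages_eq life split 1 t n) =
  (joint_law tree_law (sigma * t) t m n)%:E.
Proof. by rewrite joint_lawE !nb_lineages_eqE mul1r. Qed.

(** Tonelli for the indicator of a jointly measurable set of pairs (time, tree). *)
Lemma measurable_joint_law sigma m n :
  measurable_fun setT (fun t : R => joint_law tree_law (sigma * t) t m n).
Proof.
apply/measurable_EFinP.
pose A : set (R * @tree_space R) :=
  [set x | nb_ancestral (sigma * x.1) x.1 x.2 = m%:R%:E] `&`
  [set x | nb_ancestral x.1 x.1 x.2 = n%:R%:E].
have mA : measurable A.
  have mN (f : R * @tree_space R -> R) k : measurable_fun setT f ->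
      measurable [set x | nb_ancestral (f x) x.1 x.2 = k%:R%:E].
    move=> mf; rewrite -[X in measurable X]setTI.
    have mn : measurable_fun setT (fun x : R * @tree_space R => nb_ancestral (f x) x.1 x.2).
      exact: measurable_nb_ancestral.
    exact: (mn measurableT [set k%:R%:E]).
  apply: measurableI; apply: mN; last exact: measurable_fst.
  by apply: measurable_funM => //; exact: measurable_fst.
rewrite (_ : _ \o _ = fubini_F tree_law (EFin \o \1_A)).
  apply: measurable_fun_fubini_tonelli_F; last by move=> x; rewrite lee_fin.
  by apply/measurable_EFinP; exact: measurable_indic.
apply/funext => t; rewrite /= joint_lawE /fubini_F.
rewrite -[LHS]/(tree_law (nb_eq (sigma * t) t m `&` nb_eq t t n)).
transitivity (\int[tree_law]_w (\1_(nb_eq (sigma * t) t m `&` nb_eq t t n) w)%:E)%E.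
  rewrite integral_indic ?setIT//.
  by apply: measurableI; exact: measurable_nb_eq.
exact: eq_integral.
Qed.

End canonical_tree.

(** * The conditional expectation as one integral over the age *)

Section conditional_expectation.
Context d (T : measurableType d) (R : realType) (P : probability T R).
Variables (life : seq bool -> {RV P >-> R}) (split : seq bool -> {RV P >-> bool}).
Variables (lambda mu : R).
Hypotheses (lambda_gt0 : 0 < lambda) (mu_ge0 : 0 <= mu) (mu_le : mu <= lambda).
Hypothesis tree : birth_death_tree life split lambda mu.

Let joint sigma m n (t : R) := joint_law (tree_law life split) (sigma * t) t m n.

Let joint_ge0 sigma m n t : 0 <= joint sigma m n t.
Proof. by rewrite -lee_fin joint_lawE. Qed.

(** The probability of the population size at time t cancels between the conditional probability and
    the density of the age, leaving only the normalizing constant. *)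
Let cond_prob_q_or sigma t m n : 0 <= t ->
  (cond_prob_nb_lineages life split sigma t m n.+1 * q_or life split t n.+1 =
   (n.+1%:R * lambda)%:E * (joint sigma m n.+1 t)%:E)%E.
Proof.
move=> t0; rewrite /cond_prob_nb_lineages /q_or prob_nb_lineages_eqI.
have -> : (\int[lebesgue_measure]_(s in `[0%R, +oo[)
    P (nb_lineages_eq life split 1 s n.+1) = ((n.+1%:R * lambda)^-1)%:E)%E.
  rewrite -(@bd_mass_integral _ _ _ lambda_gt0 mu_ge0 mu_le n).
  apply: eq_integral => s; rewrite inE /= in_itv/= andbT => s0.
  by rewrite prob_nb_lineages_eq (tree_law_population lambda_gt0 mu_ge0 mu_le tree).
have nl0 : n.+1%:R * lambda != 0 by rewrite mulf_neq0 ?pnatr_eq0// gt_eqF.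
rewrite -/(joint sigma m n.+1 t).
have jle : ((joint sigma m n.+1 t)%:E <= P (nb_lineages_eq life split 1 t n.+1))%E.
  have mE r k : measurable (nb_lineages_eq life split r t k).
    rewrite nb_lineages_eqE -[X in measurable X]setTI.
    exact: (measurable_marks life split measurableT (measurable_nb_eq _ _ _)).
  rewrite /joint -prob_nb_lineages_eqI; apply: le_measure.
  - by rewrite inE; exact: measurableI.
  - by rewrite inE; exact: mE.
  - exact: subIsetr.
move: jle; rewrite prob_nb_lineages_eq (tree_law_population lambda_gt0 mu_ge0 mu_le tree)//.
set v := bd_mass lambda mu t * bd_beta lambda mu t ^+ n.
move: (joint_ge0 sigma m n.+1 t); set j := joint _ _ _ _; rewrite lee_fin => j0 jv.
rewrite !inver (negbTE (invr_neq0 nl0)) invrK.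
(* [v] vanishes only at t = 0 with at least two species; there the joint probability, bounded by
   [v], vanishes as well and both sides are 0. *)
have [v0|v0] := eqVneq v 0.
  have -> : j = 0 by apply/eqP; rewrite eq_le j0 -v0 jv.
  by rewrite v0 !mul0e !mule0.
by rewrite -!EFinM; congr EFin; field.
Qed.

(** All terms are nonnegative, so the sum over m enters the integral, where it is the mean at time
    sigma t with lag (1 - sigma) t. *)
Lemma cond_expectationE sigma n : 0 <= sigma <= 1 ->
  (cond_expectation life split sigma n.+1 = \int[lebesgue_measure]_(t in `[0%R, +oo[)
     (n.+1%:R * lambda * bd_size_biased lambda mu (sigma * t) ((1 - sigma) * t) n.+1)%:E)%E.
Proof.
move=> /andP[s0 s1].
have c0 : 0 <= n.+1%:R * lambda by rewrite mulr_ge0// ltW.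
pose f m t := (m%:R * (n.+1%:R * lambda * joint sigma m n.+1 t))%:E.
have f0 m t : (0 <= f m t)%E by rewrite lee_fin !mulr_ge0// ltW.
have mf m : measurable_fun setT (f m).
  apply/measurable_EFinP; do 2 apply: measurable_funM => //.
  exact: measurable_joint_law.
transitivity (\sum_(0 <= m <oo) \int[lebesgue_measure]_(t in `[0%R, +oo[) f m t)%E.
  apply: eq_eseriesr => m _; rewrite /cond_law.
  under eq_integral => t.
    rewrite inE /= in_itv/= andbT => t0; rewrite cond_prob_q_or//.
    over.
  rewrite -ge0_integralZl//.
  - apply: measurable_funTS; apply: measurable_funeM.
    by apply/measurable_EFinP; exact: measurable_joint_law.
  - by move=> t _; rewrite mule_ge0// lee_fin.
rewrite -integral_nneseries//; last by move=> m; apply: measurable_funTS; exact: mf.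
apply: eq_integral => t; rewrite inE /= in_itv/= andbT => t0.
have st0 : 0 <= sigma * t by exact: mulr_ge0.
have s't0 : 0 <= (1 - sigma) * t by rewrite mulr_ge0// subr_ge0.
have tE : sigma * t + (1 - sigma) * t = t by ring.
rewrite EFinM -(tree_law_mean lambda_gt0 mu_ge0 mu_le tree n.+1 st0 s't0) tE.
rewrite -nneseriesZl; last first.
  by move=> m _; rewrite lee_fin mulr_ge0// joint_ge0.
by apply: eq_eseriesr => m _; rewrite /f -EFinM /joint; congr EFin; ring.
Qed.

(** The first term of [bd_size_biased] is the law of the population size; it integrates to the total
    mass 1 of the density of the age, whence the leading 1. *)
Lemma cond_expectation_gap sigma n : 0 <= sigma <= 1 ->
  (cond_expectation life split sigma n.+1 =
   1 + (n.+1%:R * n%:R)%:E *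
     \int[lebesgue_measure]_(t in `[0%R, +oo[) (bd_gap lambda mu sigma n.-1 t)%:E)%E.
Proof.
move=> s01; rewrite cond_expectationE//.
have mgap := measurable_continuous_ge0
  (fun t => @continuous_bd_gap _ _ _ lambda_gt0 mu_ge0 mu_le sigma n.-1 t s01).
have gap0 := @bd_gap_ge0 _ _ _ lambda_gt0 mu_ge0 mu_le sigma n.-1 _ s01.
pose b := bd_beta lambda mu; pose ms := bd_mass lambda mu.
have nl0 : n.+1%:R * lambda != 0 by rewrite mulf_neq0 ?pnatr_eq0// gt_eqF.
have nl1 : 0 <= n.+1%:R * lambda by rewrite mulr_ge0// ltW.
have mmass : measurable_fun (`[0, +oo[%classic : set R) (fun t => ms t * b t ^+ n).
  apply: measurable_continuous_ge0 => t t0.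
  exact: (@continuousM _ _ ms (fun t => b t ^+ n) t
    (continuous_bd_mass lambda_gt0 mu_ge0 mu_le t0)
    (@continuous_bd_betaX _ _ _ lambda_gt0 mu_ge0 mu_le n t t0)).
have mass0 t : 0 <= t -> 0 <= ms t * b t ^+ n.
  move=> t0; apply: mulr_ge0; first by apply: ltW; exact: bd_mass_gt0.
  by apply: exprn_ge0; exact: bd_beta_ge0.
transitivity (\int[lebesgue_measure]_(t in `[0%R, +oo[)
    ((n.+1%:R * lambda)%:E * (ms t * b t ^+ n)%:E +
     (n.+1%:R * n%:R)%:E * (bd_gap lambda mu sigma n.-1 t)%:E))%E.
  apply: eq_integral => t; rewrite inE /= in_itv/= andbT => t0.
  rewrite -!EFinM -EFinD; congr EFin.
  rewrite /bd_size_biased /bd_gap (_ : sigma * t + (1 - sigma) * t = t); last by ring.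
  by rewrite -/b -/ms; ring.
rewrite ge0_integralD//; last 4 first.
- by move=> t; rewrite /= in_itv/= andbT => t0; rewrite -EFinM lee_fin mulr_ge0// mass0.
- by apply: measurable_funeM; exact/measurable_EFinP.
- by move=> t; rewrite /= in_itv/= andbT => t0; rewrite -EFinM lee_fin mulr_ge0// gap0.
- by apply: measurable_funeM; exact/measurable_EFinP.
rewrite !ge0_integralZl//; last 4 first.
- exact/measurable_EFinP.
- by move=> t; rewrite /= in_itv/= andbT => t0; rewrite lee_fin gap0.
- exact/measurable_EFinP.
- by move=> t; rewrite /= in_itv/= andbT => t0; rewrite lee_fin mass0.
rewrite bd_mass_integral// -EFinM mulfV//.
Qed.

End conditional_expectation.

(** * Change of the unit of time and explicit integrands *)

Section scaling.
Context {R : realType}.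
Implicit Types lambda mu sigma c t : R.

(** The rates and the time enter only through lambda t, mu t and the ratio mu / lambda. *)
Lemma bd_beta_scale c lambda mu t : 0 < c ->
  bd_beta (lambda / c) (mu / c) (c * t) = bd_beta lambda mu t.
Proof.
move=> c0; have cN : c != 0 by rewrite lt0r_neq0.
rewrite /bd_beta (can_eq (mulfVK cN)).
have -> : lambda / c * (c * t) = lambda * t by field.
have -> : - (lambda / c - mu / c) * (c * t) = - (lambda - mu) * t by field.
by rewrite invf_div (mulrA (mu / c)) divfK//.
Qed.

Lemma bd_gap_scale c lambda mu sigma k t : 0 < c ->
  bd_gap lambda mu sigma k t = bd_gap (lambda / c) (mu / c) sigma k (c * t) * c.
Proof.
move=> c0; have cN : c != 0 by rewrite lt0r_neq0.
rewrite /bd_gap /bd_mass (mulrCA (1 - sigma)) !bd_beta_scale//.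
by rewrite invf_div (mulrA (mu / c)) divfK// [RHS]mulrAC divfK.
Qed.

Lemma bd_gap_integral_scale c lambda mu sigma k :
  0 < c -> 0 < lambda -> 0 <= mu -> mu <= lambda -> 0 <= sigma <= 1 ->
  (\int[lebesgue_measure]_(t in `[0%R, +oo[) (bd_gap lambda mu sigma k t)%:E =
   \int[lebesgue_measure]_(t in `[0%R, +oo[)
     (bd_gap (lambda / c) (mu / c) sigma k t)%:E)%E.
Proof.
move=> c0 l0 m0 ml s01.
have l0' : 0 < lambda / c by rewrite divr_gt0.
have m0' : 0 <= mu / c by rewrite divr_ge0// ltW.
have ml' : mu / c <= lambda / c by rewrite ler_pM2r// invr_gt0.
pose F : R -> R := fun t => c * t.
have DF (t : R) : is_derive t 1 F c.
  have := is_derive_affine 0 c (is_derive_id t 1); rewrite mulr1.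
  by rewrite (_ : (fun t => 0 + c * t) = F)//; apply/funext => x; rewrite add0r.
have F'E : derive1 F = cst c by apply/funext => t; rewrite derive1E derive_val.
have F0 : F 0 = 0 by rewrite /F mulr0.
have cG := fun t => @continuous_bd_gap _ _ _ l0' m0' ml' sigma k t s01.
transitivity (\int[lebesgue_measure]_(t in `[F 0%R, +oo[)
    (bd_gap (lambda / c) (mu / c) sigma k t)%:E)%E; last by rewrite F0.
rewrite (@increasing_ge0_integration_by_substitutiony _ F
  (bd_gap (lambda / c) (mu / c) sigma k) 0).
- by apply: eq_integral => t _; rewrite F'E /= (bd_gap_scale _ _ _ _ _ c0).
- by move=> x y _ _ xy; rewrite /F ltr_pM2l.
- by rewrite F'E => x _; exact: cst_continuous.
- by rewrite F'E; exact: is_cvg_cst.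
- by rewrite F'E; exact: is_cvg_cst.
- split; first by move=> x _; exact: ex_derive.
  by apply/cvg_at_right_filter; exact: (is_derive_continuous (DF 0)).
- exact: gt0_cvgMry.
- rewrite F0; apply: continuous_in_subspaceT => x.
  by rewrite inE /= in_itv/= andbT => /cG.
- by move=> x; rewrite F0 in_itv/= andbT => /ltW x0; exact: bd_gap_ge0.
Qed.

Lemma bd_gap_critical sigma k t : 0 <= sigma <= 1 -> 0 <= t ->
  bd_gap 1 1 sigma k t =
  sigma * (t ^+ k.+1 / ((1 + (1 - sigma) * t) * (1 + t) ^+ k.+3)).
Proof.
move=> /andP[s0 s1] t0.
have d1 : 1 + t != 0 by rewrite lt0r_neq0// ltr_pwDl.
have d2 : 1 + (1 - sigma) * t != 0.
  by rewrite lt0r_neq0// ltr_pwDl// mulr_ge0// subr_ge0.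
rewrite /bd_gap /bd_mass /bd_beta eqxx !mul1r invr1 mul1r expr_div_n !exprS.
by field; rewrite d1 d2 expf_neq0.
Qed.

(** The two rates have difference 1 and ratio [rho]: they are the original ones with 1 / (lambda -
    mu) as unit of time. *)
Lemma bd_gap_noncritical rho sigma k t : 0 <= rho < 1 -> 0 <= sigma <= 1 -> 0 <= t ->
  bd_gap (1 - rho)^-1 (rho / (1 - rho)) sigma k t = (rho - 1) ^+ 2 *
    ((expR (- (2 - sigma) * t) - expR (- 2 * t)) / (1 - rho * expR (- (1 - sigma) * t)) *
     ((1 - expR (- t)) ^+ k / (1 - rho * expR (- t)) ^+ k.+3)).
Proof.
move=> /andP[r0 r1] /andP[s0 s1] t0.
have rN : 1 - rho != 0 by rewrite subr_eq0 gt_eqF.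
have den x : 0 <= x -> 1 - rho * expR (- x) != 0.
  move=> x0; rewrite subr_eq0 gt_eqF// (le_lt_trans _ r1)// ler_piMr//.
  by rewrite -expR0 ler_expR oppr_le0.
have d1 := den t t0.
have d2 : 1 - rho * expR (- ((1 - sigma) * t)) != 0.
  by rewrite den// mulr_ge0// subr_ge0.
rewrite /bd_gap /bd_mass /bd_beta.
have -> : (rho / (1 - rho) == (1 - rho)^-1) = false.
  by rewrite -[X in _ == X]mul1r (can_eq (mulfVK rN)) lt_eqF.
have -> : rho / (1 - rho) / (1 - rho)^-1 = rho by field.
have cE (x : R) : - ((1 - rho)^-1 - rho / (1 - rho)) * x = - x by field.
rewrite !cE.
have -> : - (2 - sigma) * t = - ((1 - sigma) * t) + - t by ring.
have -> : - 2 * t = - t + - t by ring.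
rewrite mulNr !expRD expr_div_n !exprS.
move: d1 d2; set E := expR _; set S := expR _ => d1 d2.
by field; rewrite rN d1 d2 expf_neq0.
Qed.

End scaling.

(** * Pure birth: the integral as a finite sum *)

Section yule.
Context {R : realType}.
Implicit Types sigma t : R.

(** Binomial expansion of (1 - exp (- t)) ^ k leaves differences of exponentials, and 1 / (j + 2 -
    sigma) - 1 / (j + 2) = sigma / ((j + 2) (j + 2 - sigma)). *)
Lemma yule_gap_integral sigma k : 0 <= sigma <= 1 ->
  (\int[lebesgue_measure]_(t in `[0%R, +oo[) (bd_gap 1 0 sigma k t)%:E =
   (\sum_(0 <= j < k.+1) 'C(k, j)%:R * ((-1) ^+ j / (j%:R + 2)) *
      (sigma / (j%:R + 2 - sigma)))%:E)%E.
Proof.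
move=> s01; have /andP[s0 s1] := s01.
have a0 (j : nat) : 0 < (j%:R + 2 - sigma : R).
  by rewrite subr_gt0 (le_lt_trans s1)// ltr_wpDl// ltr1n.
have b0 (j : nat) : 0 < (j%:R + 2 : R) by rewrite ltr_wpDl.
pose c (j : nat) : R := 'C(k, j)%:R * (-1) ^+ j.
pose h (j : 'I_k.+1) (t : R) := c j *
  (- (j%:R + 2 - sigma)^-1 * expR (- (j%:R + 2 - sigma) * t) +
   (j%:R + 2)^-1 * expR (- (j%:R + 2) * t)).
(* The primitive that vanishes at infinity, so that the integral is - F 0. *)
pose F : R -> R := \sum_(j < k.+1) h j.
have l01 : (0 : R) < 1 by [].
have FE t : F t = \sum_(j < k.+1) h j t by rewrite /F fct_sumE.
have DF (t : R) : is_derive t 1 F (\sum_(j < k.+1) c j *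
    (expR (- (j%:R + 2 - sigma) * t) - expR (- (j%:R + 2) * t))).
  apply: is_derive_sum => j.
  have D1 := is_derive_affine 0 (- (j%:R + 2 - sigma)^-1)
    (is_derive_expRM (- (j%:R + 2 - sigma)) t).
  have D2 := is_derive_affine 0 (j%:R + 2)^-1 (is_derive_expRM (- (j%:R + 2)) t).
  have D := is_derive_affine 0 (c j) (is_deriveD D1 D2).
  rewrite (_ : h j = fun u => 0 + c j * (((fun u => 0 + - (j%:R + 2 - sigma)^-1 *
     expR (- (j%:R + 2 - sigma) * u)) + (fun u => 0 + (j%:R + 2)^-1 *
     expR (- (j%:R + 2) * u))) u)); last first.
    by apply/funext => u; rewrite /h fctE !add0r.
  apply: (is_derive_eq D); congr (_ * _).
  by field; rewrite !lt0r_neq0.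
have e0 (a : R) : 0 < a -> expR (- a * t) @[t --> +oo%R] --> (0 : R).
  move=> ap; rewrite (_ : (fun t => expR (- a * t)) =
    (fun z => expR (- z)) \o (fun z => a * z)); last first.
    by apply/funext => x /=; rewrite mulNr.
  by apply: (@cvg_comp _ _ _ _ _ _ (pinfty_nbhs R)); [exact: gt0_cvgMry|exact: cvgr_expR].
rewrite (@ge0_continuous_FTC2y _ _ F 0 0).
- rewrite -EFinB sub0r FE -sumrN big_mkord; congr EFin; apply: eq_bigr => j _.
  rewrite /h /c !mulr0 expR0; field.
  by rewrite !lt0r_neq0.
- by move=> t t0; exact: bd_gap_ge0.
- apply: continuous_in_subspaceT => x; rewrite inE /= in_itv /= andbT => x0.
  exact: continuous_bd_gap.
- rewrite (_ : (fun t => F t) = (fun t => \sum_(j < k.+1) h j t)); last exact/funext.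
  rewrite [X in _ --> X](_ : 0 = \sum_(j < k.+1) c j *
    (- (j%:R + 2 - sigma)^-1 * 0 + (j%:R + 2)^-1 * 0)); last first.
    by rewrite big1// => j _; rewrite !mulr0 addr0 mulr0.
  apply: (cvg_big add_continuous) => j _; apply: cvgMl_tmp.
  by apply: cvgD; apply: cvgMl_tmp; exact: e0.
- by move=> x _; exact: ex_derive.
- by apply/cvg_at_right_filter; exact: (is_derive_continuous (DF 0)).
- move=> x; rewrite in_itv/= andbT => /ltW x0; rewrite derive1E derive_val.
  (* Rates 1 and 0 are the case [rho = 0] of the noncritical integrand. *)
  have r01 : 0 <= (0 : R) < 1 by rewrite lexx ltr01.
  have := bd_gap_noncritical k r01 s01 x0.
  rewrite subr0 invr1 mul0r sub0r sqrrN expr1n mul1r => ->.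
  rewrite !mul0r !subr0 expr1n !divr1 mulrC exprBn mulr_suml; apply: eq_bigr => j _.
  rewrite expr1n mulr1 -expRM_natl.
  have -> : - (j%:R + 2 - sigma) * x = j%:R * - x + - (2 - sigma) * x by ring.
  have -> : - (j%:R + 2) * x = j%:R * - x + - 2 * x by ring.
  by rewrite !expRD -[_ *+ 'C(k, j)]mulr_natr /c; ring.
Qed.

End yule.

(** * Assembly of the three cases *)

(** The hypotheses on [f] pass to [g] through g = f / c on the half-line. The case c = 0 is
    separate; it occurs in the critical case for sigma = 0. *)
Lemma ge0_integral_factor (R : realType) (c : R) (f g : R -> R) :
  0 <= c -> (forall t, 0 <= t -> 0 <= f t) ->
  measurable_fun (`[0, +oo[%classic : set R) f ->
  (forall t, 0 <= t -> f t = c * g t) ->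
  (\int[lebesgue_measure]_(t in `[0%R, +oo[) (f t)%:E =
   c%:E * \int[lebesgue_measure]_(t in `[0%R, +oo[) (g t)%:E)%E.
Proof.
move=> c0 f0 mf fE; have [c00|cN] := eqVneq c 0.
  rewrite c00 mul0e; apply: integral0_eq => t; rewrite /= in_itv/= andbT => t0.
  by rewrite fE// c00 mul0r.
have -> : (\int[lebesgue_measure]_(t in `[0%R, +oo[) (g t)%:E =
    \int[lebesgue_measure]_(t in `[0%R, +oo[) (c^-1%:E * (f t)%:E))%E.
  apply: eq_integral => t; rewrite inE /= in_itv/= andbT => t0.
  by rewrite -EFinM fE// mulKf.
rewrite ge0_integralZl//; last 3 first.
- exact/measurable_EFinP.
- by move=> t; rewrite /= in_itv/= andbT => t0; rewrite lee_fin f0.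
- by rewrite lee_fin invr_ge0.
by rewrite muleA -EFinM divff// mul1e.
Qed.

Theorem theorem3p3 (d : measure_display) (T : measurableType d) (R : realType)
    (P : probability T R)
    (life : seq bool -> {RV P >-> R}) (split : seq bool -> {RV P >-> bool})
    (lambda mu rho sigma : R) (n : nat)
    (lambda_gt0 : 0 < lambda) (mu_ge0 : 0 <= mu) (mu_le_lambda : mu <= lambda)
    (rhoE : rho = mu / lambda)
    (sigma_ge0 : 0 <= sigma) (sigma_le1 : sigma <= 1) (n_ge1 : (1 <= n)%N)
    (tree : birth_death_tree life split lambda mu) :
  cond_expectation life split sigma n =
  (if (mu == 0)%R then
     (1 + n%:R * (n%:R - 1) *
        \sum_(0 <= k < n.-1)
           'C(n - 2, k)%:R * ((-1) ^+ k / (k%:R + 2)) *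
           (sigma / (k%:R + 2 - sigma)))%:E
   else if (mu == lambda)%R then
     1 + (n%:R * (n%:R - 1) * sigma)%:E *
       \int[lebesgue_measure]_(t in `[0%R, +oo[)
          (t ^+ (n - 1) / ((1 + (1 - sigma) * t) * (1 + t) ^+ (n + 1)))%:E
   else
     1 + (n%:R * (n%:R - 1) * (rho - 1) ^+ 2)%:E *
       \int[lebesgue_measure]_(t in `[0%R, +oo[)
          ((expR (- (2 - sigma) * t) - expR (- 2 * t)) /
             (1 - rho * expR (- (1 - sigma) * t)) *
           ((1 - expR (- t)) ^ (n%:Z - 2) /
             (1 - rho * expR (- t)) ^+ (n + 1)))%:E)%E.
Proof.
have s01 : 0 <= sigma <= 1 by rewrite sigma_ge0.
case: n n_ge1 => [//|n1] _.
rewrite (cond_expectation_gap lambda_gt0 mu_ge0 mu_le_lambda tree)//.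
have lN : lambda != 0 by rewrite gt_eqF.
have nE : n1.+1%:R - 1 = n1%:R :> R by rewrite -natr1 addrK.
rewrite nE.
(* One species: the factor n - 1 vanishes and every case is 1. Setting this apart leaves a
   nonnegative exponent n - 2. *)
case: n1 nE => [|k] _.
  by rewrite !mulr0 !mul0r !mul0e; do 2 case: ifP => // _; rewrite addr0.
rewrite !subSS !subn0 addn1 /=.
have [mu0|muN] := eqVneq mu 0.
  rewrite (bd_gap_integral_scale k lambda_gt0 lambda_gt0)// mu0 mul0r divff//.
  by rewrite yule_gap_integral.
have [ml|mlN] := eqVneq mu lambda.
  rewrite (bd_gap_integral_scale k lambda_gt0 lambda_gt0)// ml divff//.
  rewrite [in RHS]EFinM -muleA.
  apply: (@f_equal _ _ (fun z => (1 + (k.+2%:R * k.+1%:R)%:E * z)%E)).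
  apply: ge0_integral_factor => //.
  - by move=> t; exact: bd_gap_ge0.
  - by apply: measurable_continuous_ge0 => t; exact: continuous_bd_gap.
  - by move=> t; exact: bd_gap_critical.
have ml0 : 0 < lambda - mu by rewrite subr_gt0 lt_neqAle mlN.
have r01 : 0 <= rho < 1.
  rewrite rhoE ltr_pdivrMr// mul1r -subr_gt0 ml0 andbT.
  by apply: divr_ge0 => //; exact: ltW.
have [r0 r1] := andP r01.
(* With the unit 1 / (lambda - mu) the rates depend on [rho] alone; the two cases above use the unit
   1 / lambda instead. *)
rewrite (bd_gap_integral_scale k ml0 lambda_gt0)//.
have -> : k.+2%:Z - 2 = k%:Z by rewrite -addn2 PoszD addrK.
have -> : lambda / (lambda - mu) = (1 - rho)^-1.
  by rewrite rhoE; field; rewrite lN lt0r_neq0.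
have -> : mu / (lambda - mu) = rho / (1 - rho).
  by rewrite rhoE; field; rewrite lN lt0r_neq0.
have r'0 : 0 < 1 - rho by rewrite subr_gt0.
have r'1 : 0 < (1 - rho)^-1 by rewrite invr_gt0.
have rm0 : 0 <= rho / (1 - rho) by rewrite divr_ge0// ltW.
have rml : rho / (1 - rho) <= (1 - rho)^-1 by apply: ler_piMl; exact: ltW.
rewrite [in RHS]EFinM -muleA.
apply: (@f_equal _ _ (fun z => (1 + (k.+2%:R * k.+1%:R)%:E * z)%E)).
apply: ge0_integral_factor => //.
- exact: sqr_ge0.
- by move=> t; exact: bd_gap_ge0.
- by apply: measurable_continuous_ge0 => t; exact: continuous_bd_gap.
- by move=> t; exact: bd_gap_noncritical.
Qed.
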